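(* Let $H\in C(\mathbb{R}^d)$ be convex with $H(p)>H(0)=0$ for all $p\in\mathbb{R}^d\setminus\{0\}$. Let $\zeta\in C_0([0,\infty);\mathbb{R})$, let $M(t):=\max_{0\le s\le t}\zeta(s)$ and $m(t):=\min_{0\le s\le t}\zeta(s)$, and let $u\in\mathrm{BUC}(\mathbb{R}^d\times[0,\infty))$ be a space-periodic pathwise viscosity solution of $du=H(Du)\cdot d\zeta$ in $\mathbb{R}^d\times(0,\infty)$. If there exists a sequence $t_n\to\infty$ such that $M(t_n)-m(t_n)\to\infty$, then there exists $u_\infty\in\mathbb{R}$ such that, as $t\to\infty$ and uniformly in space, $u(\cdot,t)\to u_\infty$.
   Context: $\mathrm{BUC}(X)$ is the set of bounded uniformly continuous real functions on $X$. $C_0([0,\infty);\mathbb{R})$ is the set of continuous $\zeta:[0,\infty)\to\mathbb{R}$ with $\zeta(0)=0$, and $C^1_0([0,\infty))$ is its subset of $C^1$ paths. Space-periodic means that $u(\cdot,t)$ is periodic with respect to $\mathbb{Z}^d$ for each $t$, i.e. a function on the torus $\mathbb{T}^d$. Pathwise (stochastic) viscosity solutions: for convex $H$ the solution operator is the unique continuous extension, in the path, of the classical viscosity solution operator for smooth paths. That is, $u$ is the pathwise solution of $du=H(Du)\cdot d\zeta$ with initial datum $u_0\in\mathrm{BUC}(\mathbb{R}^d)$ if, whenever $\zeta_n\in C_0^1([0,\infty))$ converge to $\zeta$ locally uniformly on $[0,\infty)$ and $u_{0,n}\in \mathrm{BUC}(\mathbb{R}^d)$ converge to $u_0$ uniformly,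 the (Crandall-Lions) viscosity solutions $u_n$ of $u_{n,t}=H(Du_n)\dot\zeta_n$ with $u_n(\cdot,0)=u_{0,n}$ converge to $u$ uniformly on $\mathbb{R}^d\times[0,T]$ for every $T>0$. It is known that such a solution exists and is unique. *)

(* Defs.v *)
From HB Require Import structures.
From mathcomp Require Import all_boot all_order all_algebra.
From mathcomp Require Import all_classical all_reals all_analysis.

Set Implicit Arguments.
Unset Strict Implicit.
Unset Printing Implicit Defensive.

Import Order.TTheory GRing.Theory Num.Theory.
Import numFieldNormedType.Exports.

Local Open Scope classical_set_scope.
Local Open Scope ring_scope.

(* A point of R^d x [0, +oo) is a pair (x, t); functions are total on R^d x R
   (paths: on R), and only their values at times t >= 0 are ever used. *)

Section paths.
Variable R : realType.
Implicit Types (zeta : R -> R) (t : R).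

Definition C0_path zeta : Prop :=
  zeta 0 = 0 /\ {within `[0, +oo[, continuous zeta}.

(* C^1 up to the boundary: the derivative on (0, +oo) is continuous and has a
   finite limit at 0 (equivalently, by the mean value theorem, the right
   derivative at 0 exists and extends it continuously). *)
Definition C1_path zeta : Prop :=
  [/\ zeta 0 = 0,
      derivable_oy_Rcontinuous zeta 0,
      {in `]0, +oo[, continuous (derive1 zeta)} &
      cvg (derive1 zeta t @[t --> 0^'+])].

(* For a continuous path the sup and inf below are attained. *)
Definition running_max zeta t : R := sup [set zeta s | s in `[0, t]].
Definition running_min zeta t : R := inf [set zeta s | s in `[0, t]].

End paths.

Definition BUC (R : realType) (V : normedModType R) (A : set V) (f : V -> R) :
    Prop :=
  [bounded f x | x in A] /\ @unif_continuous (subspace A) R f.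

Section viscosity.
Variables (R : realType) (d : nat).
Local Notation space := 'rV[R]_d.
Local Notation spacetime := ('rV[R]_d * R)%type.
Implicit Types (H : space -> R) (zeta xi : R -> R) (u phi : spacetime -> R).

Definition halfspace : set spacetime := [set: space] `*` `[0, +oo[.
Definition slab (T : R) : set spacetime := [set: space] `*` `[0, T].

Definition time_derivative phi (z : spacetime) : R :=
  'D_((0, 1) : spacetime) phi z.

Definition space_gradient phi (z : spacetime) : space :=
  \row_(i < d) 'D_((delta_mx ord0 i, 0) : spacetime) phi z.

(* C^1 on the open set R^d x (0, +oo); as the dimension is finite, continuity of
   the differential is continuity of each of its directional values. *)
Definition test_function phi : Prop :=
  forall z : spacetime, 0 < z.2 ->
    differentiable phi z /\
    forall v : spacetime, {for z, continuous (fun w => 'D_v phi w)}.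

Definition viscosity_subsolution H xi u : Prop :=
  forall phi (z : spacetime), test_function phi -> 0 < z.2 ->
    (\forall w \near z, u w - phi w <= u z - phi z) ->
    time_derivative phi z <= H (space_gradient phi z) * derive1 xi z.2.

Definition viscosity_supersolution H xi u : Prop :=
  forall phi (z : spacetime), test_function phi -> 0 < z.2 ->
    (\forall w \near z, u z - phi z <= u w - phi w) ->
    H (space_gradient phi z) * derive1 xi z.2 <= time_derivative phi z.

(* The Crandall-Lions solution of u_t = H(Du) xi'(t), u(., 0) = u0, in the class
   in which it is unique. *)
Definition viscosity_solution H xi (u0 : space -> R) u : Prop :=
  [/\ forall T : R, 0 < T -> BUC (slab T) u,
      forall x : space, u (x, 0) = u0 x,
      viscosity_subsolution H xi u &
      viscosity_supersolution H xi u].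

Definition pathwise_solution H zeta (u0 : space -> R) u : Prop :=
  forall (xi : nat -> R -> R) (v0 : nat -> space -> R)
         (v : nat -> spacetime -> R),
    (forall n, C1_path (xi n)) ->
    (forall T : R, 0 < T -> {uniform `[0, T], xi @ \oo --> zeta}) ->
    (forall n, BUC [set: space] (v0 n)) ->
    {uniform, v0 @ \oo --> u0} ->
    (forall n, viscosity_solution H (xi n) (v0 n) (v n)) ->
    forall T : R, 0 < T -> {uniform slab T, v @ \oo --> u}.

Definition space_periodic u : Prop :=
  forall (t : R) (x : space) (k : 'rV[int]_d), 0 <= t ->
    u (x + map_mx intr k, t) = u (x, t).

End viscosity.

Arguments halfspace R d : clear implicits.

(* Main.v *)
Require Import Defs.
From HB Require Import structures.
From mathcomp Require Import all_boot all_order all_algebra.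
From mathcomp Require Import all_classical all_reals all_analysis.
From mathcomp Require Import ring lra.

Set Implicit Arguments.
Unset Strict Implicit.
Unset Printing Implicit Defensive.

Import Order.TTheory GRing.Theory Num.Theory.
Import numFieldNormedType.Exports.

Local Open Scope classical_set_scope.
Local Open Scope ring_scope.

(** The solution operator is known explicitly along a monotone path. On increasing
    pieces it is the Hopf-Lax operator
    [S t W x = sup_y (W y - t * H^*((y - x) / t))], with [t] the increase of the path,
    and on decreasing pieces it is the analogous infimum, obtained from the first
    by the reflection that replaces [u], [zeta], [H p] by [- u], [- zeta], [H (- p)].

    Three facts make the solution flatten. The operators are increasing semigroups that
    shrink the range of a function, because [H] has its minimum [0] at [0]. A decrease
    that follows an increase of the same size can only raise the solution
    ([hopf_lax_closing]); hence, while the path stays above its value at some time,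
    the solution dominates what the direct increase would give ([evolution_above]).
    Finally, since [0] is the only minimum of [H], the Lagrangian [H^*] is
    differentiable at [0], so that after a large increase the displacement to a
    maximum point in the same period costs almost nothing ([cost_vanishes]). Together:
    if the path has a large oscillation up to time [T], then between its extrema the
    minimum of the solution comes close to the preceding maximum (or conversely), and
    the solution stays within a small interval at all times after [T]
    ([evolution_flat_up], [evolution_flat_down]). This makes [u] a Cauchy function of
    time, uniformly in space.

    A pathwise solution is only known through the classical solutions that converge
    to it, so such solutions are constructed. The path is replaced by a [zigzag],
    a C^1 path that agrees with it on a mesh, is monotone between mesh points and rests
    around each of them, and the datum by Lipschitz ones. For data with Lipschitz
    constant [L] only the values of [H] on a bounded set of momenta matter; restricting
    the Legendre transform to a cube of size [L + 1] gives a finite Lipschitz cost,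
    while the margin [1] gives finite speed of propagation. The viscosity
    inequalities for [S] follow from its dynamic programming principle
    ([hopf_lax_subsolution], [hopf_lax_supersolution]); the second one uses the
    convexity of [H], through an approximate subgradient. Along a zigzag the solution is
    a composition of such operators, and thanks to the rests it is near any time
    driven by a single monotone piece ([zigzag_sol_solution_at]). *)

(** * Epsilon-delta forms of uniform convergence and continuity *)

Lemma uniform_cvg_seqP {R : realType} {U : choiceType} (A : set U)
    (v : nat -> U -> R) (f : U -> R) :
  {uniform A, v @ \oo --> f} <->
  forall e : R, 0 < e ->
    exists N : nat, forall n x, (N <= n)%N -> A x -> `|f x - v n x| < e.
Proof.
split=> [h e e0|h].
  have : nbhs (f : {uniform` A -> R})
      [set g : {uniform` A -> R} | forall x, A x -> `|f x - g x| < e].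
    apply/uniform_nbhs; exists [set xy : R * R | `|xy.1 - xy.2| < e].
    by split => //; rewrite -entourage_ballE; exists e => // -[x y]/=.
  by move/h => [N _ hN]; exists N => n x Nn; apply: hN.
move=> P /uniform_nbhs[E [entE sEP]].
move: entE; rewrite -entourage_ballE => -[e /= e0 eE].
have [N hN] := h _ e0.
exists N => // n /= Nn; apply: sEP => y Ay; apply: (eE (f y, v n y)).
exact: hN.
Qed.

Lemma BUCP {R : realType} {V : normedModType R} (A : set V) (f : V -> R) :
  BUC A f <->
  (exists B, forall x, A x -> `|f x| <= B) /\
  (forall e : R, 0 < e -> exists2 r : R, 0 < r &
     forall x y, A x -> A y -> `|x - y| < r -> `|f x - f y| < e).
Proof.
split=> -[bf uf]; split.
- have [M [_ hM]] := bf; exists (M + 1) => x Ax.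
  by apply: hM => //; rewrite ltrDl.
- move=> e e0.
  have : entourage [set xy : R * R | `|xy.1 - xy.2| < e].
    by rewrite -entourage_ballE; exists e => // -[x y].
  move=> /uf [E /= entE sE]; move: entE; rewrite -entourage_ballE => -[r /= r0 rE].
  exists r => // x y Ax Ay xy; apply: (sE (x, y)); right; do 2!split => //.
  by apply: rE; rewrite /= -ball_normE.
- have [B hB] := bf; exists B; split; first exact: num_real.
  by move=> M BM x Ax; exact: le_trans (hB _ Ax) (ltW BM).
- move=> E; rewrite -entourage_ballE => -[e /= e0 eE].
  have [r r0 hr] := uf _ e0.
  exists [set xy : V * V | `|xy.1 - xy.2| < r].
    by rewrite -entourage_ballE; exists r => // -[x y]; rewrite /= -ball_normE.
  move=> [x y] /= [<-|[Ax [Ay xy]]]; apply: eE => /=.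
    by rewrite /ball/= subrr normr0.
  exact: hr.
Qed.

Lemma within_continuous_uniform {R : realType} (f : R -> R) (T e : R) :
  {within `[0, +oo[, continuous f} -> 0 < e ->
  exists2 r : R, 0 < r &
    forall s t, 0 <= s <= T -> 0 <= t <= T -> `|s - t| < r -> `|f s - f t| < e.
Proof.
move=> /subspace_continuousP fc e0.
have : compact `[0, T] by exact: segment_compact.
move=> /compact_near_coveringP cov.
have := cov R (0^'+)
  (fun r s => 0 <= s -> forall t, 0 <= t -> `|s - t| < r -> `|f s - f t| < e) _.
case.
  move=> x; rewrite /= in_itv/= => /andP[x0 _].
  have /fc : `[0, +oo[%classic x by rewrite /= in_itv/= x0.
  move=> /cvgr_dist_lt /(_ (e / 2)).
  have e2 : 0 < e / 2 by rewrite divr_gt0.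
  move=> /(_ e2); rewrite near_withinE.
  move=> [r /= r0 hr].
  have r2 : 0 < r / 2 by rewrite divr_gt0.
  exists (ball x (r / 2), [set i | i < r / 2]) => /=.
    split; first exact: nbhsx_ballx.
    exact: nbhs_right_lt.
  move=> [y i]/= [xy ir] y0 t t0 yt.
  have hy : `|f x - f y| < e / 2.
    apply: hr; last by rewrite in_itv/= y0.
    by rewrite /ball/= in xy *; lra.
  have ht : `|f x - f t| < e / 2.
    apply: hr; last by rewrite in_itv/= t0.
    rewrite /ball/= in xy *; have := ler_distD y x t; lra.
  have := ler_distD (f x) (f y) (f t); rewrite (distrC (f y) (f x)); lra.
move=> r /= r0 hr; exists (r / 2) => /=; first by rewrite divr_gt0.
move=> s t /andP[s0 sT] /andP[t0 tT] st; apply: (hr (r / 2)) => //=.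
  rewrite sub0r normrN gtr0_norm ?divr_gt0// ltr_pdivrMr// ltr_pMr// ltr1n//.
by rewrite divr_gt0.
by rewrite in_itv/= s0.
Qed.

(** * The duality between the sup norm and the 1-norm *)

Section pairing.
Variables (R : realType) (d : nat).
Implicit Types (p q x y z : 'rV[R]_d) (K t : R).

Definition dot p z : R := \sum_i p ord0 i * z ord0 i.
Definition norm1 z : R := \sum_i `|z ord0 i|.

Lemma dotDl p q z : dot (p + q) z = dot p z + dot q z.
Proof. by rewrite -big_split; apply: eq_bigr => i _; rewrite mxE mulrDl. Qed.

Lemma dotDr p y z : dot p (y + z) = dot p y + dot p z.
Proof. by rewrite -big_split; apply: eq_bigr => i _; rewrite mxE mulrDr. Qed.

Lemma dotZl t p z : dot (t *: p) z = t * dot p z.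
Proof. by rewrite mulr_sumr; apply: eq_bigr => i _; rewrite mxE mulrA. Qed.

Lemma dotC p z : dot p z = dot z p.
Proof. by apply: eq_bigr => i _; rewrite mulrC. Qed.

Lemma dotZr t p z : dot p (t *: z) = t * dot p z.
Proof. by rewrite dotC dotZl dotC. Qed.

Lemma dotNr p z : dot p (- z) = - dot p z.
Proof. by rewrite -scaleN1r dotZr mulN1r. Qed.

Lemma dotNl p z : dot (- p) z = - dot p z.
Proof. by rewrite dotC dotNr dotC. Qed.

Lemma dot0r p : dot p 0 = 0.
Proof. by rewrite -(scale0r 0) dotZr mul0r. Qed.

Lemma dot0l z : dot 0 z = 0.
Proof. by rewrite dotC dot0r. Qed.

Lemma dot_ge0 z : 0 <= dot z z.
Proof. by apply: sumr_ge0 => i _; rewrite -expr2 sqr_ge0. Qed.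

Lemma norm1_ge0 z : 0 <= norm1 z.
Proof. exact: sumr_ge0. Qed.

Lemma norm10 : norm1 0 = 0.
Proof. by apply: big1 => i _; rewrite mxE normr0. Qed.

Lemma norm1N z : norm1 (- z) = norm1 z.
Proof. by apply: eq_bigr => i _; rewrite mxE normrN. Qed.

Lemma norm1_distC y z : norm1 (y - z) = norm1 (z - y).
Proof. by rewrite -norm1N opprB. Qed.

Lemma norm1Z t z : norm1 (t *: z) = `|t| * norm1 z.
Proof. by rewrite mulr_sumr; apply: eq_bigr => i _; rewrite mxE normrM. Qed.

Lemma ler_norm_coord z i : `|z ord0 i| <= `|z|.
Proof.
have := @le_bigmax _ _ _ 0 (fun ij : 'I_1 * 'I_d => `|z ij.1 ij.2|) (ord0, i).
by rewrite /Num.norm/= mx_normrE.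
Qed.

Lemma norm_leP z K : 0 <= K -> (forall i, `|z ord0 i| <= K) -> `|z| <= K.
Proof.
move=> K0 h; rewrite /Num.norm/= mx_normrE; apply: bigmax_le => // -[i j] _ /=.
by rewrite ord1.
Qed.

Lemma norm_le_norm1 z : `|z| <= norm1 z.
Proof.
apply: norm_leP => [|i]; first exact: norm1_ge0.
by rewrite /norm1 (bigD1 i)//= lerDl sumr_ge0.
Qed.

Lemma norm1_le z : norm1 z <= d%:R * `|z|.
Proof.
rewrite mulr_natl -[X in _ *+ X](card_ord d) -sumr_const.
by apply: ler_sum => i _; exact: ler_norm_coord.
Qed.

Lemma dot_le p z : dot p z <= `|p| * norm1 z.
Proof.
rewrite mulr_sumr; apply: ler_sum => i _.
apply: le_trans (ler_norm _) _; rewrite normrM ler_wpM2r//.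
exact: ler_norm_coord.
Qed.

Lemma dot_attains_norm1 K z : 0 <= K ->
  exists2 p, `|p| <= K & dot p z = K * norm1 z.
Proof.
move=> K0; exists (\row_i (K * Num.sg (z ord0 i))).
  apply: norm_leP => // i; rewrite mxE normrM (ger0_norm K0).
  by rewrite ler_piMr// normr_sg; case: (_ == 0).
rewrite mulr_sumr; apply: eq_bigr => i _.
by rewrite mxE -mulrA -normrEsg.
Qed.

Lemma sqr_norm_le_dot z : `|z| ^+ 2 <= dot z z.
Proof.
rewrite -(sqr_sqrtr (dot_ge0 z)) ler_pXn2r// ?nnegrE ?sqrtr_ge0//.
apply: norm_leP => [|i]; first exact: sqrtr_ge0.
rewrite -sqrtr_sqr ler_sqrt ?dot_ge0// expr2 /dot (bigD1 i)//= lerDl.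
by apply: sumr_ge0 => j _; rewrite -expr2 sqr_ge0.
Qed.

Lemma continuous_sqdist (p0 : 'rV[R]_d) :
  continuous (fun p => dot (p - p0) (p - p0)).
Proof.
have cB i : continuous (fun p : 'rV[R]_d => (p - p0) ord0 i).
  rewrite (_ : (fun p => _) = fun p : 'rV[R]_d => p ord0 i - p0 ord0 i).
    by move=> p; exact: (cvgB (@coord_continuous R 1 d ord0 i p) (cvg_cst _)).
  by apply/funext => p; rewrite !mxE.
apply: continuous_big => [|i _ p]; first exact: add_continuous.
exact: (cvgM (cB i p) (cB i p)).
Qed.

End pairing.

(** * Hamiltonians *)

Section hamiltonian.
Variables (R : realType) (d : nat).
Implicit Types (p q z : 'rV[R]_d) (K t e : R) (H : 'rV[R]_d -> R).

Definition hamiltonian H : Prop :=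
  [/\ continuous H,
      forall t p q, 0 <= t <= 1 ->
        H (t *: p + (1 - t) *: q) <= t * H p + (1 - t) * H q,
      H 0 = 0 &
      forall p, p != 0 -> 0 < H p].

Lemma convex_hamiltonian H : continuous H ->
  convex_function [set: 'rV[R]_d] H -> H 0 = 0 ->
  (forall p, p != 0 -> 0 < H p) -> hamiltonian H.
Proof.
move=> cH vH H0 Hpos; split => // t p q /andP[t0 t1].
by have := vH (Itv01 t0 t1) p q (mem_set I) (mem_set I).
Qed.

Lemma hamiltonian_ge0 H p : hamiltonian H -> 0 <= H p.
Proof.
move=> [_ _ H0 Hpos]; have [->|/Hpos/ltW//] := eqVneq p 0.
by rewrite H0.
Qed.

Lemma hamiltonian_opp H : hamiltonian H -> hamiltonian (H \o -%R).
Proof.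
move=> [cH vH H0 Hpos]; split => /=.
- by move=> p; apply: continuous_comp; [exact: opp_continuous|exact: cH].
- by move=> t p q t01; rewrite opprD -!scalerN vH.
- by rewrite oppr0.
- by move=> p p0; rewrite Hpos// oppr_eq0.
Qed.

Lemma compact_cube K : compact [set p : 'rV[R]_d | `|p| <= K].
Proof.
apply: bounded_closed_compact.
  by exists K; split; [exact: num_real|move=> M KM p /= pK; exact: le_trans pK (ltW KM)].
rewrite (_ : [set _ | _] = Num.norm @^-1` [set x | x <= K])//.
by apply: preimage_closed => [p _|]; [exact: norm_continuous|exact: closed_le].
Qed.

Lemma hamiltonian_bounded H K : hamiltonian H -> 0 <= K ->
  exists2 C, 0 <= C & forall p, `|p| <= K -> H p <= C.
Proof.
move=> hamH K0; have [cH _ _ _] := hamH.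
have [||c _ hc] := @EVT_max_rV R d H _ _ (@compact_cube K).
- by exists 0; rewrite /= normr0.
- exact: continuous_subspaceT.
exists (H c); first exact: hamiltonian_ge0.
by move=> p pK; apply: hc; rewrite inE.
Qed.

(** Convexity turns positivity on a small sphere into linear growth outside. *)
Lemma hamiltonian_growth H e : hamiltonian H -> 0 < e ->
  exists2 c : R, 0 < c & forall p, e <= `|p| -> c * `|p| <= H p.
Proof.
move=> hamH e0; have [cH vH H0 Hpos] := hamH.
have scaleS p : e <= `|p| -> `|(e / `|p|) *: p| = e.
  move=> ep; have p0 : 0 < `|p| by exact: lt_le_trans ep.
  by rewrite normrZ gtr0_norm ?divr_gt0// divfK// gt_eqF.
pose S := [set p : 'rV[R]_d | `|p| = e].
have [[p0 Sp0]|S0] := pselect (S !=set0); last first.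
  exists 1 => // p ep; exfalso; apply: S0; exists ((e / `|p|) *: p).
  exact: scaleS.
have cS : compact S.
  apply: bounded_closed_compact.
    by exists e; split; [exact: num_real|move=> M eM p /= ->; exact: ltW].
  rewrite (_ : S = Num.norm @^-1` [set e])//.
  by apply: preimage_closed => [p _|]; [exact: norm_continuous|exact: closed_eq].
have [||c /set_mem Sc hc] := @EVT_min_rV R d H S _ cS.
- by exists p0.
- exact: continuous_subspaceT.
have c0 : c != 0 by rewrite -normr_gt0 Sc.
exists (H c / e); first by rewrite divr_gt0// Hpos.
move=> p ep; have p_gt0 : 0 < `|p| by exact: lt_le_trans ep.
have t01 : 0 <= e / `|p| <= 1.
  by rewrite divr_ge0 ?(ltW e0)//= ler_pdivrMr// mul1r.
have := vH _ p 0 t01; rewrite scaler0 addr0 H0 mulr0 addr0.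
have : H c <= H ((e / `|p|) *: p) by apply: hc; rewrite inE; exact: scaleS.
move=> /le_trans/[apply] => hcp.
rewrite mulrAC ler_pdivrMr// -ler_pdivlMr//.
by apply: le_trans hcp _; rewrite mulrAC (mulrC (H p)).
Qed.

(** The Moreau-Yosida minimizer of [H] near [p0] is close to [p0], and the first
    order condition there is an exact subgradient inequality at a point where
    [H] is almost [H p0]. *)
Lemma approximate_subgradient H p0 K e : hamiltonian H -> 0 < e ->
  exists q, forall p, `|p| <= K -> H p0 - e + dot q (p - p0) <= H p.
Proof.
move=> hamH e0; have [cH vH _ _] := hamH.
have [r r0 hr] : exists2 r : R, 0 < r & forall p, `|p0 - p| < r -> H p0 - e < H p.
  have /cvgr_dist_lt /(_ e e0) := cH p0.
  move=> /nbhs_normP [r /= r0 hr]; exists r => // p /hr /=.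
  by have := ler_norm (H p0 - H p); lra.
pose N := (2 * H p0 + 1) / r ^+ 2.
have Hp0 : 0 <= H p0 by exact: hamiltonian_ge0.
have N0 : 0 < N by rewrite divr_gt0 ?exprn_gt0//; lra.
pose F p := H p + N / 2 * dot (p - p0) (p - p0).
pose B := Num.max K `|p0|.
have [||p1 /set_mem /= p1B hp1] := @EVT_min_rV R d F _ _ (@compact_cube B).
- by exists p0; rewrite /= /B le_max lexx orbT.
- apply: continuous_subspaceT => p.
  have h1 := cvgM (cvg_cst (N / 2)) (@continuous_sqdist R d p0 p).
  exact: (cvgD (cH p) (h1 _ _)).
have Fp1 : F p1 <= F p0 by apply: hp1; rewrite inE /= /B le_max lexx orbT.
have Hp1 : H p0 - e < H p1.
  apply: hr; apply: contraTT Fp1; rewrite -leNgt -ltNge => hrp.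
  have r2 : r ^+ 2 <= dot (p1 - p0) (p1 - p0).
    apply: le_trans (sqr_norm_le_dot _).
    by rewrite distrC ler_pXn2r// ?nnegrE// ltW.
  rewrite /F subrr dot0r mulr0 addr0.
  have : N / 2 * r ^+ 2 <= N / 2 * dot (p1 - p0) (p1 - p0).
    by rewrite ler_pM2l// divr_gt0.
  have -> : N / 2 * r ^+ 2 = H p0 + 2^-1 by rewrite /N; field; rewrite gt_eqF.
  have := hamiltonian_ge0 p1 hamH; lra.
exists (N *: (p0 - p1)) => p pK.
have pB : `|p| <= B by rewrite /B le_max pK.
(* Compare p1 with the points p1 + t (p - p1) and let t tend to 0. *)
have first_order t : 0 < t -> t <= 1 ->
    H p1 <= H p + N * dot (p1 - p0) (p - p1) + t * (N / 2 * dot (p - p1) (p - p1)).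
  move=> t0 t1.
  have t01 : 0 <= t <= 1 by rewrite ltW.
  have ptB : `|t *: p + (1 - t) *: p1| <= B.
    rewrite (le_trans (ler_normD _ _))// !normrZ !ger0_norm ?subr_ge0 ?(ltW t0)//.
    have : t * `|p| <= t * B by rewrite ler_pM2l.
    have : (1 - t) * `|p1| <= (1 - t) * B by rewrite ler_wpM2l// subr_ge0.
    lra.
  have : F p1 <= F (t *: p + (1 - t) *: p1) by apply: hp1; rewrite inE.
  have -> : F (t *: p + (1 - t) *: p1) = H (t *: p + (1 - t) *: p1) +
      N / 2 * (dot (p1 - p0) (p1 - p0) + 2 * t * dot (p1 - p0) (p - p1) +
               t ^+ 2 * dot (p - p1) (p - p1)).
    rewrite /F; congr (_ + _ * _).
    have -> : t *: p + (1 - t) *: p1 - p0 = (p1 - p0) + t *: (p - p1).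
      by apply/rowP => i; rewrite !mxE; ring.
    move: (p1 - p0) (p - p1) => a b.
    by rewrite !(dotDl, dotDr) !(dotZl, dotZr) (dotC b a); ring.
  have := vH t p p1 t01; rewrite /F => hv hF.
  by rewrite -(ler_pM2l t0); lra.
have Hlim : H p1 <= H p + N * dot (p1 - p0) (p - p1).
  apply/ler_addgt0Pr => eta eta0.
  set c := N / 2 * dot (p - p1) (p - p1) in first_order.
  have c0 : 0 <= c by rewrite mulr_ge0 ?dot_ge0// divr_ge0// ltW.
  pose t := Num.min 1 (eta / (c + 1)).
  have t0 : 0 < t by rewrite lt_min ltr01 divr_gt0//; lra.
  have := first_order t t0; rewrite ge_min lexx => /(_ isT).
  suff : t * c <= eta by lra.
  apply: le_trans (_ : eta / (c + 1) * c <= _).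
    by rewrite ler_wpM2r// ge_min lexx orbT.
  by rewrite mulrAC ler_pdivrMr ?ler_pM2l//; lra.
have -> : p - p0 = (p - p1) + (p1 - p0) by rewrite addrA subrK.
rewrite dotZl dotDr -(opprB p1 p0) !dotNl.
have := dot_ge0 (p1 - p0) => /(mulr_ge0 (ltW N0)); lra.
Qed.

End hamiltonian.

(** * The truncated Lagrangian cost *)

Section cost.
Variables (R : realType) (d : nat).
Implicit Types (p q y z : 'rV[R]_d) (K r s t e b C : R) (H : 'rV[R]_d -> R).

(** [cost H K t z] is [t * L (z / t)] for the Legendre transform [L] of the function
    equal to [H] on the cube of size [K] and infinite outside: the truncation keeps it
    finite even where [H^*] is infinite. *)
Definition cost H K t z : R :=
  sup [set dot p z - t * H p | p in [set p | `|p| <= K]].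

Lemma cost_le H K t z b : 0 <= K ->
  (forall p, `|p| <= K -> dot p z - t * H p <= b) -> cost H K t z <= b.
Proof.
move=> K0 h; apply: ge_sup => [|_ [p pK <-]]; last exact: h.
by exists (dot 0 z - t * H 0); exists 0 => //=; rewrite normr0.
Qed.

Section hamiltonian_cost.
Variables (H : 'rV[R]_d -> R) (K : R).
Hypotheses (hamH : hamiltonian H) (K0 : 0 <= K).
Local Notation c := (cost H K).

Let H_ge0 p : 0 <= H p := hamiltonian_ge0 p hamH.

Lemma cost_ge t z p : 0 <= t -> `|p| <= K -> dot p z - t * H p <= c t z.
Proof.
move=> t0 pK; apply: ub_le_sup; last by exists p.
exists (K * norm1 z) => _ [q /= qK <-].
have := dot_le q z; have := mulr_ge0 t0 (H_ge0 q).
have : `|q| * norm1 z <= K * norm1 z by rewrite ler_wpM2r// norm1_ge0.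
lra.
Qed.

Lemma cost_ge0 t z : 0 <= t -> 0 <= c t z.
Proof.
move=> t0; have := @cost_ge t z 0 t0; rewrite normr0 => /(_ K0).
by have [_ _ -> _] := hamH; rewrite dot0l mulr0 subr0.
Qed.

Lemma cost_le_norm1 t z : 0 <= t -> c t z <= K * norm1 z.
Proof.
move=> t0; apply: cost_le => // p pK.
have := dot_le p z; have := mulr_ge0 t0 (H_ge0 p).
have : `|p| * norm1 z <= K * norm1 z by rewrite ler_wpM2r// norm1_ge0.
lra.
Qed.

Lemma cost_at0 t : 0 <= t -> c t 0 = 0.
Proof.
move=> t0; apply/eqP; rewrite eq_le cost_ge0// andbT.
by have := cost_le_norm1 0 t0; rewrite norm10 mulr0.
Qed.

Lemma costD s t y z : 0 <= s -> 0 <= t -> c (s + t) (y + z) <= c s y + c t z.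
Proof.
move=> s0 t0; apply: cost_le => // p pK.
have := cost_ge y s0 pK; have := cost_ge z t0 pK.
by rewrite dotDr; lra.
Qed.

Lemma costZ_le t r z : 0 <= t -> 0 <= r -> c (r * t) (r *: z) <= r * c t z.
Proof.
move=> t0 r0; apply: cost_le => // p pK.
have := ler_wpM2l r0 (cost_ge z t0 pK).
by rewrite dotZr; lra.
Qed.

Lemma cost_lip t y z : 0 <= t -> c t y <= c t z + K * norm1 (y - z).
Proof.
move=> t0; apply: cost_le => // p pK.
have := cost_ge z t0 pK; have := dot_le p (y - z).
have : `|p| * norm1 (y - z) <= K * norm1 (y - z) by rewrite ler_wpM2r// norm1_ge0.
have -> : dot p y = dot p (y - z) + dot p z by rewrite -dotDr subrK.
lra.
Qed.

Lemma cost_nincr s t z : 0 <= s -> s <= t -> c t z <= c s z.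
Proof.
move=> s0 st; apply: cost_le => // p pK.
have := cost_ge z s0 pK; have : s * H p <= t * H p by rewrite ler_wpM2r.
lra.
Qed.

Section bounded.
Variable C : R.
Hypothesis HC : forall p, `|p| <= K -> H p <= C.

Lemma cost_time s t z : 0 <= s -> s <= t -> c s z <= c t z + C * (t - s).
Proof.
move=> s0 st; apply: cost_le => // p pK.
have := cost_ge z (le_trans s0 st) pK.
have : (t - s) * H p <= (t - s) * C by rewrite ler_wpM2l ?HC// subr_ge0.
lra.
Qed.

(** This is finite speed of propagation: for data with Lipschitz constant below [K],
    a displacement that is long compared with [t] costs more than it gains. *)
Lemma cost_coercive t z : 0 <= t -> K * norm1 z - C * t <= c t z.
Proof.
move=> t0; have [p pK pz] := dot_attains_norm1 z K0.
have := cost_ge z t0 pK; rewrite pz.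
have : t * H p <= t * C by rewrite ler_wpM2l ?HC.
lra.
Qed.

End bounded.

Lemma cost0 z : c 0 z = K * norm1 z.
Proof.
apply/eqP; rewrite eq_le cost_le_norm1//=.
have [p pK <-] := dot_attains_norm1 z K0.
by have := cost_ge z (lexx 0) pK; rewrite mul0r subr0.
Qed.

End hamiltonian_cost.

Lemma cost_opp H K t z : cost (H \o -%R) K t z = cost H K t (- z).
Proof.
congr sup; apply/seteqP; split=> _ [p /= pK <-]; exists (- p) => //=;
  rewrite ?normrN// ?opprK ?dotNl ?dotNr ?opprK//.
Qed.

(** Differentiability of the Lagrangian at the origin, that is, uniqueness of the
    minimum of [H]: momenta of size at least [e / (r + 1)] pay linear growth of [H], and
    smaller ones gain at most [e]. The threshold does not depend on the cut-off [K],
    which grows with the precision of the Lipschitz approximation of the datum. *)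
Lemma cost_vanishes H r e : hamiltonian H -> 0 <= r -> 0 < e ->
  exists2 T, 0 <= T & forall K t z, 0 <= K -> T <= t -> norm1 z <= r ->
    cost H K t z <= e.
Proof.
move=> hamH r0 e0.
have de0 : 0 < e / (r + 1) by rewrite divr_gt0//; lra.
have [k k0 Hk] := hamiltonian_growth hamH de0.
exists (r / k); first by rewrite divr_ge0// ltW.
move=> K t z K0 Tt zr; apply: cost_le => // p pK.
have t0 : 0 <= t by apply: le_trans Tt; rewrite divr_ge0// ltW.
have pz : dot p z <= `|p| * r by apply: le_trans (dot_le p z) _; rewrite ler_wpM2l.
have [/Hk kp|/ltW pe] := lerP (e / (r + 1)) `|p|.
  have : t * (k * `|p|) <= t * H p by rewrite ler_wpM2l.
  have : r * `|p| <= t * k * `|p| by rewrite ler_wpM2r// -ler_pdivrMr.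
  lra.
have : `|p| * r <= e / (r + 1) * r by rewrite ler_wpM2r.
have : e / (r + 1) * r <= e.
  by rewrite mulrAC ler_pdivrMr ?ler_pM2l//; lra.
have := mulr_ge0 t0 (hamiltonian_ge0 p hamH).
lra.
Qed.

End cost.

(** * The Hopf-Lax operator *)

Section hopf_lax.
Variables (R : realType) (d : nat).
Implicit Types (x y z : 'rV[R]_d) (K L B s t a b e C : R).
Implicit Types (H W V : 'rV[R]_d -> R).

Definition hopf_lax H K t W x : R :=
  sup [set W y - cost H K t (y - x) | y in [set: 'rV[R]_d]].

Definition lipschitz1 L W := forall x y, W y - W x <= L * norm1 (y - x).
Definition bounded_by B W := forall x, `|W x| <= B.
Definition periodic W := forall x (k : 'rV[int]_d), W (x + map_mx intr k) = W x.

Lemma lipschitz1N L W : lipschitz1 L W -> lipschitz1 L (fun x => - W x).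
Proof. by move=> h x y; have := h y x; rewrite norm1_distC; lra. Qed.

Lemma bounded_byN B W : bounded_by B W -> bounded_by B (fun x => - W x).
Proof. by move=> h x; rewrite normrN. Qed.

Lemma periodicN W : periodic W -> periodic (fun x => - W x).
Proof. by move=> h x k; rewrite h. Qed.

Lemma periodic_close W x y : periodic W ->
  exists2 w, norm1 (w - x) <= d%:R & W w = W y.
Proof.
move=> perW; pose k : 'rV[int]_d := \row_i - Num.floor (y ord0 i - x ord0 i).
exists (y + map_mx intr k) => //.
rewrite -[d in d%:R]card_ord -sumr_const; apply: ler_sum => i _.
rewrite !mxE mulrNz.
have := floor_le (y ord0 i - x ord0 i); have := floorD1_gt (y ord0 i - x ord0 i).
by rewrite intrD ler_norml; lra.
Qed.

Lemma hopf_lax_le H K t W x b :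
  (forall y, W y - cost H K t (y - x) <= b) -> hopf_lax H K t W x <= b.
Proof.
move=> h; apply: ge_sup => [|_ [y _ <-]]; last exact: h.
by exists (W 0 - cost H K t (0 - x)); exists 0.
Qed.

Lemma hopf_lax_gt H K t W x b : b < hopf_lax H K t W x ->
  exists y, b < W y - cost H K t (y - x).
Proof.
move=> hb; apply: contrapT => h; move: hb; rewrite ltNge => /negP; apply.
by apply: hopf_lax_le => y; rewrite leNgt; apply/negP => hy; apply: h; exists y.
Qed.

Section fixed_hamiltonian.
Variables (H : 'rV[R]_d -> R) (K : R).
Hypotheses (hamH : hamiltonian H) (K0 : 0 <= K).
Local Notation S := (hopf_lax H K).
Local Notation c := (cost H K).

Lemma hopf_lax_ge t W B x y : 0 <= t -> bounded_by B W ->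
  W y - c t (y - x) <= S t W x.
Proof.
move=> t0 hB; apply: ub_le_sup; last by exists y.
exists B => _ [z _ <-]; have := cost_ge0 hamH K0 (z - x) t0.
by have := hB z; rewrite ler_norml; lra.
Qed.

Lemma hopf_lax_ge_id t W B x : 0 <= t -> bounded_by B W -> W x <= S t W x.
Proof.
move=> t0 hB; have := hopf_lax_ge x x t0 hB.
by rewrite subrr cost_at0// subr0.
Qed.

Lemma hopf_lax_le_ub t W b x : 0 <= t -> (forall y, W y <= b) -> S t W x <= b.
Proof.
move=> t0 hb; apply: hopf_lax_le => y.
by have := hb y; have := cost_ge0 hamH K0 (y - x) t0; lra.
Qed.

Lemma hopf_lax_bounded t W B : 0 <= t -> bounded_by B W -> bounded_by B (S t W).
Proof.
move=> t0 hB x; rewrite ler_norml; apply/andP; split.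
  apply: le_trans (hopf_lax_ge_id x t0 hB).
  by have := hB x; rewrite ler_norml => /andP[].
by apply: hopf_lax_le_ub => // y; have := hB y; rewrite ler_norml => /andP[].
Qed.

Lemma hopf_lax_translate t W B e z x : 0 <= t -> bounded_by B W ->
  (forall y, W y <= W (y + z) + e) -> S t W x <= S t W (x + z) + e.
Proof.
move=> t0 hB h; apply: hopf_lax_le => y.
have := hopf_lax_ge (x + z) (y + z) t0 hB.
by rewrite opprD addrACA subrr addr0; have := h y; lra.
Qed.

Lemma hopf_lax_lipschitz t W B L : 0 <= t -> bounded_by B W -> lipschitz1 L W ->
  lipschitz1 L (S t W).
Proof.
move=> t0 hB hL x y; rewrite lerBlDl.
have := @hopf_lax_translate t W B (L * norm1 (y - x)) (x - y) y t0 hB.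
rewrite subrKC; apply => w.
have := hL (w + (x - y)) w.
have -> : w - (w + (x - y)) = y - x by apply/rowP => i; rewrite !mxE; ring.
lra.
Qed.

(** Because the cost is [K]-Lipschitz in the displacement. For [t = 0] this is how
    a datum is made Lipschitz. *)
Lemma hopf_lax_regular t W B : 0 <= t -> bounded_by B W -> lipschitz1 K (S t W).
Proof.
move=> t0 hB x y; rewrite lerBlDl; apply: hopf_lax_le => w.
have := hopf_lax_ge x w t0 hB.
have := cost_lip hamH K0 (w - x) (w - y) t0.
have -> : w - x - (w - y) = y - x by apply/rowP => i; rewrite !mxE; ring.
lra.
Qed.

Lemma hopf_lax_periodic t W B : 0 <= t -> bounded_by B W -> periodic W ->
  periodic (S t W).
Proof.
move=> t0 hB hp x k; apply/eqP; rewrite eq_le; apply/andP; split.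
  have := @hopf_lax_translate t W B 0 (- map_mx intr k) (x + map_mx intr k) t0 hB.
  rewrite addrK addr0; apply => y.
  by rewrite -[in leLHS](subrK (map_mx intr k) y) hp addr0.
rewrite -[leRHS]addr0; apply: hopf_lax_translate => // y.
by rewrite hp addr0.
Qed.

Lemma hopf_lax_shift t W V B e x : 0 <= t -> bounded_by B V ->
  (forall y, W y <= V y + e) -> S t W x <= S t V x + e.
Proof.
move=> t0 hB h; apply: hopf_lax_le => y.
by have := hopf_lax_ge x y t0 hB; have := h y; lra.
Qed.

Lemma hopf_lax_mono t W V B x : 0 <= t -> bounded_by B V ->
  (forall y, W y <= V y) -> S t W x <= S t V x.
Proof.
move=> t0 hB h; rewrite -[leRHS]addr0; apply: (hopf_lax_shift _ t0 hB) => y.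
by rewrite addr0.
Qed.

Lemma hopf_lax0 W B : bounded_by B W -> lipschitz1 K W -> S 0 W = W.
Proof.
move=> hB hK; apply/funext => x; apply/eqP; rewrite eq_le.
rewrite (hopf_lax_ge_id _ _ hB)// andbT; apply: hopf_lax_le => y.
by rewrite cost0//; have := hK x y; lra.
Qed.

(** The displacement is cut in the ratio [s : t]; by homogeneity the cost is additive
    along such a cut. *)
Lemma hopf_lax_intermediate s t x w : 0 <= s -> 0 <= t ->
  exists y, c t (w - y) + c s (y - x) <= c (s + t) (w - x).
Proof.
move=> s0 t0; have st0 : 0 <= s + t by exact: addr_ge0.
have [st|st] := eqVneq (s + t) 0.
  have [-> ->] : s = 0 /\ t = 0 by lra.
  by exists x; rewrite subrr (cost_at0 hamH K0)// !addr0.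
have r0 : 0 <= s / (s + t) by rewrite divr_ge0.
have r1 : 0 <= t / (s + t) by rewrite divr_ge0.
exists (x + (s / (s + t)) *: (w - x)).
have hs := costZ_le hamH K0 (w - x) st0 r0.
have ht := costZ_le hamH K0 (w - x) st0 r1.
move: hs ht; rewrite !divfK//.
have -> : (t / (s + t)) *: (w - x) = w - (x + (s / (s + t)) *: (w - x)).
  by apply/rowP => i; rewrite !mxE; field.
rewrite [x + _]addrC addrK.
have : s / (s + t) * c (s + t) (w - x) + t / (s + t) * c (s + t) (w - x) =
       c (s + t) (w - x) by field.
lra.
Qed.

Lemma hopf_laxD s t W B : 0 <= s -> 0 <= t -> bounded_by B W ->
  S (s + t) W = S s (S t W).
Proof.
move=> s0 t0 hB; apply/funext => x; apply/eqP; rewrite eq_le; apply/andP; split.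
  apply: hopf_lax_le => w; have [y hy] := hopf_lax_intermediate x w s0 t0.
  have := hopf_lax_ge x y s0 (hopf_lax_bounded t0 hB).
  by have := hopf_lax_ge y w t0 hB; lra.
apply: hopf_lax_le => y; rewrite lerBlDr; apply: hopf_lax_le => w.
have := hopf_lax_ge x w (addr_ge0 s0 t0) hB.
have := costD hamH K0 (y - x) (w - y) s0 t0.
by rewrite [y - x + _]addrC addrA subrK; lra.
Qed.

Lemma hopf_lax_time s t W B C x : (forall p, `|p| <= K -> H p <= C) ->
  0 <= s -> s <= t -> bounded_by B W ->
  S s W x <= S t W x <= S s W x + C * (t - s).
Proof.
move=> HC s0 st hB; have t0 := le_trans s0 st; apply/andP; split.
  apply: hopf_lax_le => y; have := hopf_lax_ge x y t0 hB.
  by have := cost_nincr hamH K0 (y - x) s0 st; lra.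
apply: hopf_lax_le => y; have := hopf_lax_ge x y s0 hB.
by have := cost_time hamH K0 HC (y - x) s0 st; lra.
Qed.

Lemma hopf_lax_flat t W B e : 0 <= t -> bounded_by B W -> periodic W ->
  (forall z, norm1 z <= d%:R -> c t z <= e) -> forall x y, W y - e <= S t W x.
Proof.
move=> t0 hB hp he x y; have [w wx <-] := periodic_close x y hp.
by have := hopf_lax_ge x w t0 hB; have := he _ wx; lra.
Qed.

(** The infimum defining the backward evolution is over points [y] at which the forward
    evolution could have used the value at [x], at the same cost. *)
Lemma hopf_lax_closing t W B x : 0 <= t -> bounded_by B W ->
  W x <= - hopf_lax (H \o -%R) K t (fun y => - S t W y) x.
Proof.
move=> t0 hB; rewrite lerNr; apply: hopf_lax_le => y.
rewrite cost_opp opprB; have := hopf_lax_ge y x t0 hB; lra.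
Qed.

End fixed_hamiltonian.

End hopf_lax.

(** * Evolution along a piecewise monotone path *)

Section evolution.
Variables (R : realType) (d : nat).
Implicit Types (x y z : 'rV[R]_d) (K L B s t a b e C : R).
Implicit Types (H W V : 'rV[R]_d -> R).

(** For [a < 0] this is an infimal convolution, written as the reflection of the
    supremal one so that its properties follow by symmetry. *)
Definition evolution H K a W x : R :=
  if 0 <= a then hopf_lax H K a W x
  else - hopf_lax (H \o -%R) K (- a) (fun y => - W y) x.

Definition regular K B W := bounded_by B W /\ lipschitz1 K W.

Lemma regularN K B W : regular K B W -> regular K B (fun x => - W x).
Proof. by move=> [hB hK]; split; [exact: bounded_byN|exact: lipschitz1N]. Qed.

Lemma comp_oppK H : (H \o -%R) \o -%R = H.
Proof. by apply/funext => x /=; rewrite opprK. Qed.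

Lemma opp_funK W : (fun x => - - W x) = W.
Proof. by apply/funext => x; rewrite opprK. Qed.

Section fixed_hamiltonian.
Variables (K : R).
Hypothesis (K0 : 0 <= K).

(** Changing the sign of the solution reverses the path and reflects [H]; it
    exchanges the two branches of the definition. *)
Lemma evolutionN H a W B : hamiltonian H -> regular K B W ->
  (fun x => - evolution H K a W x) =
  evolution (H \o -%R) K (- a) (fun x => - W x).
Proof.
move=> hamH regW; have hamH' := hamiltonian_opp hamH.
apply/funext => x; rewrite /evolution oppr_ge0 comp_oppK opp_funK opprK.
have [a0|a0] := lerP 0 a.
  have [->|an0] := eqVneq a 0; last by rewrite leNgt lt_neqAle eq_sym an0 a0.
  have [hB hK] := regW; have [hB' hK'] := regularN regW.
  by rewrite lexx oppr0 !(hopf_lax0 _ K0 (B := B))//.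
by rewrite ltW// opprK.
Qed.

Lemma evolutionE H a W : 0 <= a -> evolution H K a W = hopf_lax H K a W.
Proof. by move=> a0; apply/funext => x; rewrite /evolution a0. Qed.

Lemma evolution0 H W B : hamiltonian H -> regular K B W -> evolution H K 0 W = W.
Proof. by move=> hamH [hB hK]; rewrite evolutionE// (hopf_lax0 hamH K0 hB hK). Qed.

Lemma evolution_decr H a W B : hamiltonian H -> regular K B W -> a <= 0 ->
  evolution H K a W =
  (fun x => - hopf_lax (H \o -%R) K (- a) (fun y => - W y) x).
Proof.
move=> hamH regW a0; rewrite -evolutionE ?oppr_ge0//.
by rewrite -(evolutionN a hamH regW) opp_funK.
Qed.

(** Reduces estimates that are symmetric under the reflection to increasing paths. *)
Lemma evolution_ind (P : ('rV[R]_d -> R) -> ('rV[R]_d -> R) -> Prop) H a W B :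
  hamiltonian H -> regular K B W ->
  (forall V, P (fun x => - W x) V -> P W (fun x => - V x)) ->
  (forall H' a' W', hamiltonian H' -> 0 <= a' -> W' = W \/ W' = (fun x => - W x) ->
    P W' (hopf_lax H' K a' W')) ->
  P W (evolution H K a W).
Proof.
move=> hamH regW hN hpos; have [a0|/ltW a0] := lerP 0 a.
  by rewrite evolutionE//; apply: hpos => //; left.
rewrite (evolution_decr hamH regW a0); apply: hN.
by apply: hpos; [exact: hamiltonian_opp|rewrite oppr_ge0|right].
Qed.

Lemma evolution_bounded H a W B : hamiltonian H -> regular K B W ->
  bounded_by B (evolution H K a W).
Proof.
move=> hamH regW; apply: (evolution_ind (P := fun _ => bounded_by B) _ hamH regW).
  by move=> V; exact: bounded_byN.
move=> H' a' W' hamH' a'0 eW'; apply: hopf_lax_bounded => //.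
by case: eW' => ->; [exact: regW.1|exact: bounded_byN regW.1].
Qed.

Lemma evolution_lipschitz H a W B L : hamiltonian H -> regular K B W ->
  lipschitz1 L W -> lipschitz1 L (evolution H K a W).
Proof.
move=> hamH regW hL.
apply: (evolution_ind (P := fun _ => lipschitz1 L) _ hamH regW).
  by move=> V; exact: lipschitz1N.
move=> H' a' W' hamH' a'0 eW'; apply: (@hopf_lax_lipschitz _ _ _ _ hamH' K0 _ _ B) => //.
  by case: eW' => ->; [exact: regW.1|exact: bounded_byN regW.1].
by case: eW' => ->//; exact: lipschitz1N.
Qed.

Lemma evolution_periodic H a W B : hamiltonian H -> regular K B W ->
  periodic W -> periodic (evolution H K a W).
Proof.
move=> hamH regW hL.
apply: (evolution_ind (P := fun _ => @periodic R d) _ hamH regW).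
  by move=> V; exact: periodicN.
move=> H' a' W' hamH' a'0 eW'; apply: (@hopf_lax_periodic _ _ _ _ hamH' K0 _ _ B) => //.
  by case: eW' => ->; [exact: regW.1|exact: bounded_byN regW.1].
by case: eW' => ->//; exact: periodicN.
Qed.

Lemma evolution_range H a W B l b : hamiltonian H -> regular K B W ->
  (forall y, l <= W y <= b) -> forall x, l <= evolution H K a W x <= b.
Proof.
move=> hamH regW hlb x; rewrite /evolution; case: ifPn => [a0|].
  apply/andP; split.
    apply: le_trans (hopf_lax_ge_id hamH K0 x a0 regW.1).
    by case/andP: (hlb x).
  by apply: hopf_lax_le_ub => // y; case/andP: (hlb y).
rewrite -ltNge => /ltW a0; have hamH' := hamiltonian_opp hamH.
have a0' : 0 <= - a by rewrite oppr_ge0.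
apply/andP; split.
  rewrite lerNr; apply: hopf_lax_le_ub => // y.
  by rewrite lerN2; case/andP: (hlb y).
rewrite lerNl.
apply: le_trans (hopf_lax_ge_id hamH' K0 x a0' (bounded_byN regW.1)).
by rewrite lerN2; case/andP: (hlb x).
Qed.

Lemma evolution_shift H a W V B e : hamiltonian H -> regular K B W ->
  regular K B V -> (forall y, W y <= V y + e) ->
  forall x, evolution H K a W x <= evolution H K a V x + e.
Proof.
move=> hamH regW regV h x; have [a0|/ltW a0] := lerP 0 a.
  by rewrite !evolutionE//; exact: hopf_lax_shift regV.1 h.
rewrite (evolution_decr hamH regW a0) (evolution_decr hamH regV a0).
have a0' : 0 <= - a by rewrite oppr_ge0.
rewrite lerNl opprD opprK lerBlDr.
apply: (hopf_lax_shift (hamiltonian_opp hamH) K0 _ a0' (bounded_byN regW.1)) => y.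
by have := h y; lra.
Qed.

Lemma evolution_time H a b W B C x : hamiltonian H ->
  (forall p, `|p| <= K -> H p <= C) -> regular K B W ->
  0 <= a /\ 0 <= b \/ a <= 0 /\ b <= 0 ->
  `|evolution H K a W x - evolution H K b W x| <= C * `|a - b|.
Proof.
move=> hamH HC regW ab.
suff incr H' V s t : hamiltonian H' -> (forall p, `|p| <= K -> H' p <= C) ->
    bounded_by B V -> 0 <= s -> 0 <= t ->
    `|hopf_lax H' K s V x - hopf_lax H' K t V x| <= C * `|s - t|.
  case: ab => -[a0 b0]; first by rewrite !evolutionE//; exact: incr regW.1 _ _.
  rewrite !(evolution_decr hamH regW)// opprK addrC.
  have -> : `|a - b| = `|- b - - a| by rewrite opprK addrC.
  apply: incr; rewrite ?oppr_ge0//; first exact: hamiltonian_opp.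
    by move=> p pK; apply: HC; rewrite normrN.
  exact: bounded_byN regW.1.
wlog st : s t / s <= t.
  move=> h hamH' HC' hB s0 t0; have [st|/ltW ts] := leP s t; first exact: h.
  by rewrite distrC (distrC s); exact: h.
move=> hamH' HC' hB s0 t0; have := hopf_lax_time hamH' K0 x HC' s0 st hB.
move=> /andP[le_st le_ts].
by rewrite distrC (distrC s) !ger0_norm ?subr_ge0//; lra.
Qed.

(** By induction on [k]. An ascent is added by the semigroup property; a descent
    undoes the end of the direct increase, up to a gain, by [hopf_lax_closing]. *)
Lemma evolution_above H (A : nat -> 'rV[R]_d -> R) (Z : nat -> R) B i k :
  hamiltonian H -> (forall l, regular K B (A l)) ->
  (forall l, A l.+1 = evolution H K (Z l.+1 - Z l) (A l)) -> (i <= k)%N ->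
  (forall l, (i <= l <= k)%N -> Z i <= Z l) ->
  forall x, hopf_lax H K (Z k - Z i) (A i) x <= A k x.
Proof.
move=> hamH regA evA; elim: k => [|k IH].
  rewrite leqn0 => /eqP -> _ x; rewrite subrr.
  by rewrite (hopf_lax0 hamH K0 (regA 0%N).1 (regA 0%N).2).
rewrite leq_eqVlt => /predU1P[->|]; last rewrite ltnS => ik.
  move=> _ x; rewrite subrr.
  by rewrite (hopf_lax0 hamH K0 (regA k.+1).1 (regA k.+1).2).
move=> hZ x.
have Zk : 0 <= Z k - Z i by rewrite subr_ge0 hZ// ik leqnSn.
have Zk1 : 0 <= Z k.+1 - Z i by rewrite subr_ge0 hZ// leqnn leqW.
have {}IH y : hopf_lax H K (Z k - Z i) (A i) y <= A k y.
  by apply: IH => // l /andP[il lk]; rewrite hZ// il leqW.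
have hBi := (regA i).1.
rewrite evA; have [a0|/ltW a0] := lerP 0 (Z k.+1 - Z k).
  rewrite evolutionE//.
  have -> : Z k.+1 - Z i = (Z k.+1 - Z k) + (Z k - Z i) by ring.
  rewrite (hopf_laxD hamH K0 a0 Zk hBi).
  exact: (hopf_lax_mono hamH K0 _ a0 (regA k).1).
rewrite (evolution_decr hamH (regA k) a0).
have a0' : 0 <= - (Z k.+1 - Z k) by rewrite oppr_ge0.
apply: le_trans (hopf_lax_closing hamH K0 x a0' (hopf_lax_bounded hamH K0 Zk1 hBi)) _.
rewrite -(hopf_laxD hamH K0 a0' Zk1 hBi) lerN2.
have -> : - (Z k.+1 - Z k) + (Z k.+1 - Z i) = Z k - Z i by ring.
apply: (hopf_lax_mono (hamiltonian_opp hamH) K0 _ a0') => [|y].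
  exact: bounded_byN (hopf_lax_bounded hamH K0 Zk hBi).
by rewrite lerN2.
Qed.

(** By [evolution_above] the values at time [k] are nearly above the maximum at time [i],
    and that maximum bounds everything that follows. *)
Lemma evolution_flat_up H A Z B i k e :
  hamiltonian H -> (forall l, regular K B (A l)) ->
  (forall l, A l.+1 = evolution H K (Z l.+1 - Z l) (A l)) -> (i <= k)%N ->
  (forall l, (i <= l <= k)%N -> Z i <= Z l) -> periodic (A i) ->
  (forall z, norm1 z <= d%:R -> cost H K (Z k - Z i) z <= e) ->
  forall x y, A k y <= A k x + e.
Proof.
move=> hamH regA evA ik hZ perA he x y.
have Zk : 0 <= Z k - Z i by rewrite subr_ge0 hZ// ik leqnn.
pose b := A k x + e.
have Ai z : - B <= A i z <= b.
  apply/andP; split; first by have := (regA i).1 z; rewrite ler_norml => /andP[].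
  have := evolution_above hamH regA evA ik hZ x.
  have := hopf_lax_flat hamH K0 Zk (regA i).1 perA he x z.
  rewrite /b; lra.
suff : forall l z, (i <= l)%N -> - B <= A l z <= b by move=> /(_ _ y ik)/andP[].
elim=> [z|l IH z]; first by rewrite leqn0 => /eqP i0; rewrite -i0.
rewrite leq_eqVlt => /predU1P[<-//|]; rewrite ltnS => il.
by rewrite evA; apply: (evolution_range _ hamH (regA l)) => w; exact: IH.
Qed.

(** The reflection of [evolution_flat_up]. *)
Lemma evolution_flat_down H A Z B i k e :
  hamiltonian H -> (forall l, regular K B (A l)) ->
  (forall l, A l.+1 = evolution H K (Z l.+1 - Z l) (A l)) -> (i <= k)%N ->
  (forall l, (i <= l <= k)%N -> Z l <= Z i) -> periodic (A i) ->
  (forall z, norm1 z <= d%:R -> cost H K (Z i - Z k) z <= e) ->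
  forall x y, A k y <= A k x + e.
Proof.
move=> hamH regA evA ik hZ perA he x y.
have := @evolution_flat_up (H \o -%R) (fun l x => - A l x) (fun l => - Z l) B i k e
  (hamiltonian_opp hamH).
have -> : A k y <= A k x + e = (- A k x <= - A k y + e) by apply/idP/idP; lra.
apply => //.
- by move=> l; exact: regularN.
- move=> l; rewrite evA (evolutionN _ hamH (regA l)).
  by congr (evolution _ _ _ _); ring.
- by move=> l /hZ; rewrite lerN2.
- exact: periodicN.
- by move=> z zd; rewrite cost_opp addrC opprK; apply: he; rewrite norm1N.
Qed.

End fixed_hamiltonian.
End evolution.

(** * First order expansions *)

Section first_order.
Variable R : realType.

Lemma differentiable_expansion (V : normedModType R) (f : V -> R) z e :
  differentiable f z -> (0 : R) < e ->
  exists2 r : R, 0 < r &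
    forall h, `|h| < r -> `|f (z + h) - f z - 'd f z h| <= e * `|h|.
Proof.
move=> df e0.
have /eqaddoP /(_ _ e0) := diff_locally df.
move=> /nbhs_normP [r /= r0 hr]; exists r => // h hh.
have := hr h; rewrite /= sub0r normrN => /(_ hh).
by rewrite !fctE /= opprD addrA (addrC h).
Qed.

Lemma derivable_expansion (f : R -> R) t e : derivable f t 1 -> 0 < e ->
  exists2 r : R, 0 < r &
    forall h, `|h| < r -> `|f (t + h) - f t - h * derive1 f t| <= e * `|h|.
Proof.
move=> /derivable1_diffP df e0.
have [r r0 hr] := differentiable_expansion df e0.
by exists r => // h /hr; rewrite diff1E//.
Qed.

Lemma common_step (r1 r2 r3 C : R) : 0 < r1 -> 0 < r2 -> 0 < r3 -> 0 <= C ->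
  exists r, [/\ 0 < r, r < r1 /\ C * r < r1, r < r2 & r < r3 /\ C * r < r3].
Proof.
move=> r10 r20 r30 C0; pose m := Num.min r1 (Num.min r2 r3).
have m0 : 0 < m by rewrite !lt_min r10 r20.
have C2 : 0 < C + 2 by lra.
have rm : m / (C + 2) < m by rewrite ltr_pdivrMr ?ltr_pMr//; lra.
have Crm : C * (m / (C + 2)) < m.
  by rewrite mulrCA gtr_pMr// ltr_pdivrMr ?mul1r; lra.
exists (m / (C + 2)); rewrite divr_gt0//.
by move: rm Crm; rewrite !lt_min => /and3P[? ? ?] /and3P[? ? ?].
Qed.

Variable d : nat.
Implicit Types (phi : 'rV[R]_d * R -> R) (z : 'rV[R]_d * R).

Lemma test_function_expansion phi z e : test_function phi -> 0 < z.2 -> 0 < e ->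
  exists2 r : R, 0 < r &
    forall q s, norm1 q < r -> `|s| < r ->
      `|phi (z.1 + q, z.2 + s) - phi z -
        (dot (space_gradient phi z) q + s * time_derivative phi z)|
      <= e * (norm1 q + `|s|).
Proof.
move=> tphi z0 e0; have [dphi _] := tphi z z0.
have [r r0 hr] := differentiable_expansion dphi e0.
exists r => // q s qr sr.
have E : 'd phi z (q, s) = dot (space_gradient phi z) q + s * time_derivative phi z.
  have -> : (q, s) = \sum_(i < d) q ord0 i *: (delta_mx ord0 i, 0) + s *: (0, 1)
      :> ('rV[R]_d * R)%type.
    have morphD : {morph (fun x : 'rV[R]_d => (x, 0 : R)) : x y / x + y >-> x + y}.
      by move=> x y; congr pair; rewrite addr0.
    rewrite [q in LHS]row_sum_delta.
    have -> : (\sum_j q ord0 j *: delta_mx ord0 j, s) =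
        (\sum_j q ord0 j *: delta_mx ord0 j, 0) + s *: (0, 1) :> ('rV[R]_d * R)%type.
      by congr pair; rewrite /= ?scaler0 ?addr0 ?add0r// [s *: _]mulr1.
    congr (_ + _); rewrite (big_morph _ morphD (erefl _)).
    by apply: eq_bigr => i _; congr pair; rewrite /= scaler0.
  rewrite linearD linear_sum linearZ; congr (_ + _).
    apply: eq_bigr => i _; rewrite linearZ /space_gradient mxE deriveE// mulrC.
    by [].
  by rewrite /time_derivative deriveE.
have nqs : `|(q, s)| <= norm1 q + `|s|.
  rewrite prod_normE/= ge_max; have := norm_le_norm1 q.
  have := norm1_ge0 q; have := normr_ge0 s; lra.
have : `|(q, s)| < r.
  by rewrite prod_normE/= gt_max sr (le_lt_trans (norm_le_norm1 q)).
move=> /hr; rewrite E.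
have -> : z + (q, s) = (z.1 + q, z.2 + s) by case: (z).
move=> /le_trans; apply.
by rewrite ler_pM2l.
Qed.

Lemma near_displacement (P : 'rV[R]_d * R -> Prop) z : (\forall w \near z, P w) ->
  exists2 r : R, 0 < r &
    forall q s, norm1 q < r -> `|s| < r -> P (z.1 + q, z.2 + s).
Proof.
move=> /nbhs_normP[r /= r0 hr]; exists r => // q s qr sr; apply: hr => /=.
have -> : z - (z.1 + q, z.2 + s) = (- q, - s).
  by case: (z) => x t; congr pair; rewrite /= opprD addrA subrr add0r.
by rewrite prod_normE/= !normrN gt_max sr (le_lt_trans (norm_le_norm1 q)).
Qed.

End first_order.

(** * Viscosity inequalities at a point *)

Section pointwise_viscosity.
Variables (R : realType) (d : nat).
Local Notation space := 'rV[R]_d.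
Local Notation spacetime := ('rV[R]_d * R)%type.
Implicit Types (H : space -> R) (u v phi : spacetime -> R) (z : spacetime) (r : R).

Definition subsolution_at H r u z : Prop :=
  forall phi, test_function phi ->
    (\forall w \near z, u w - phi w <= u z - phi z) ->
    time_derivative phi z <= H (space_gradient phi z) * r.

Definition supersolution_at H r u z : Prop :=
  forall phi, test_function phi ->
    (\forall w \near z, u z - phi z <= u w - phi w) ->
    H (space_gradient phi z) * r <= time_derivative phi z.

Definition solution_at H r u z := subsolution_at H r u z /\ supersolution_at H r u z.

Lemma solution_at_near H r u v z : (\forall w \near z, u w = v w) ->
  solution_at H r u z -> solution_at H r v z.
Proof.
move=> uv [hsub hsup]; have uvz := nbhs_singleton uv.
split=> phi tphi hphi; [apply: hsub => //|apply: hsup => //];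
  by near=> w; rewrite uvz (near uv w)//; near: w.
Unshelve. all: by end_near.
Qed.

Lemma test_functionN phi : test_function phi -> test_function (fun w => - phi w).
Proof.
move=> tphi z z0; have [dphi cphi] := tphi z z0; split; first exact: differentiableN.
move=> v.
have near_pos : \forall w \near z, 0 < w.2.
  exists ([set: space], [set t | 0 < t]) => /=.
    by split; [exact: filterT|exact: lt_nbhsr].
  by move=> -[x t] [].
have dN w : 0 < w.2 -> 'D_v (fun w => - phi w) w = - 'D_v phi w.
  by move=> w0; rewrite deriveN//; apply: diff_derivable; exact: (tphi w w0).1.
rewrite /prop_for /continuous_at (dN _ z0).
apply: (@cvg_trans _ ((fun w => - 'D_v phi w) @ z)).
  by apply: near_eq_cvg; near=> w; rewrite dN//; near: w.
exact: cvgN (cphi v).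
Unshelve. all: by end_near.
Qed.

Lemma time_derivativeN phi z : test_function phi -> 0 < z.2 ->
  time_derivative (fun w => - phi w) z = - time_derivative phi z.
Proof.
move=> tphi z0; have [dphi _] := tphi z z0.
by rewrite /time_derivative deriveN//; exact: diff_derivable.
Qed.

Lemma space_gradientN phi z : test_function phi -> 0 < z.2 ->
  space_gradient (fun w => - phi w) z = - space_gradient phi z.
Proof.
move=> tphi z0; have [dphi _] := tphi z z0; apply/rowP => i.
by rewrite !mxE deriveN//; exact: diff_derivable.
Qed.

Lemma solution_atN H r u z : 0 < z.2 ->
  solution_at (H \o -%R) (- r) (fun w => - u w) z -> solution_at H r u z.
Proof.
move=> z0 [hsub hsup]; split=> phi tphi hphi.
  have hN : \forall w \near z, - u z - - phi z <= - u w - - phi w.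
    by near=> w; rewrite -!opprD lerN2; near: w.
  have := hsup _ (test_functionN tphi) hN.
  by rewrite space_gradientN// time_derivativeN//= opprK mulrN lerN2.
have hN : \forall w \near z, - u w - - phi w <= - u z - - phi z.
  by near=> w; rewrite -!opprD lerN2; near: w.
have := hsub _ (test_functionN tphi) hN.
by rewrite space_gradientN// time_derivativeN//= opprK mulrN lerN2.
Unshelve. all: by end_near.
Qed.

(** This places the gradients of test functions in the cube over which the cost is
    a supremum, so that [cost_ge] applies to them. *)
Lemma touching_gradient u phi z L : test_function phi -> 0 < z.2 -> 0 <= L ->
  lipschitz1 L (fun x => u (x, z.2)) ->
  (\forall w \near z, u w - phi w <= u z - phi z) ->
  `|space_gradient phi z| <= L.
Proof.
move=> tphi z0 L0 hL hphi; set p := space_gradient phi z.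
apply: norm_leP => // i; apply/ler_addgt0Pr => e e0.
have [r r0 hr] := test_function_expansion tphi z0 e0.
have [rho rho0 hrho] := near_displacement hphi.
pose h := Num.min r rho / 2.
have h0 : 0 < h by rewrite divr_gt0// lt_min r0.
have hmin : h < Num.min r rho by rewrite ltr_pdivrMr// ltr_pMr ?ltr1n// lt_min r0.
have [hr' hrho'] : h < r /\ h < rho by move: hmin; rewrite lt_min => /andP.
have step s : `|s| = h -> - s * p ord0 i <= (L + e) * h.
  move=> sh; pose q : 'rV[R]_d := s *: delta_mx ord0 i.
  have nq : norm1 q = h.
    rewrite /norm1 (bigD1 i)//= big1 ?addr0; last first.
      by move=> j ji; rewrite !mxE (negbTE ji) andbF mulr0 normr0.
    by rewrite !mxE !eqxx mulr1.
  have pq : dot p q = s * p ord0 i.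
    rewrite /q dotZr; congr (_ * _); rewrite /dot (bigD1 i)//= big1 ?addr0.
      by rewrite !mxE !eqxx mulr1.
    by move=> j ji; rewrite !mxE (negbTE ji) andbF mulr0.
  have := hr q 0; have := hrho q 0; rewrite nq normr0.
  move=> /(_ hrho' rho0) ht /(_ hr' r0); rewrite mul0r !addr0 pq.
  have := hL (z.1 + q) z.1; rewrite opprD addrA subrr add0r norm1N nq.
  move: ht; rewrite addr0; case: (z) => x t /= ht hx.
  by rewrite ler_norml => /andP[]; lra.
have h1 := step _ (gtr0_norm h0).
have := step (- h); rewrite normrN gtr0_norm// opprK => /(_ erefl) h2.
by rewrite ler_norml; apply/andP; split; rewrite -(ler_pM2l h0); lra.
Qed.

End pointwise_viscosity.

(** * The Hopf-Lax operator solves the equation *)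

Section hopf_lax_viscosity.
Variables (R : realType) (d : nat) (H : 'rV[R]_d -> R) (L B : R).
Hypotheses (hamH : hamiltonian H) (L0 : 0 <= L).
Variables (W : 'rV[R]_d -> R) (g : R -> R).
Hypotheses (W_bounded : bounded_by B W) (W_lipschitz : lipschitz1 L W).
Hypotheses (g_ge0 : forall t, 0 <= g t) (g_nondecr : {homo g : s t / s <= t}).
Local Notation K := (L + 1).

Let K0 : 0 <= K. Proof. by rewrite addr_ge0. Qed.
Let u (w : 'rV[R]_d * R) : R := hopf_lax H K (g w.2) W w.1.

Let u_bounded t : bounded_by B (fun y => u (y, t)).
Proof. exact: (hopf_lax_bounded hamH K0 (g_ge0 t) W_bounded). Qed.

Let u_lipschitz t : lipschitz1 L (fun y => u (y, t)).
Proof. exact: (hopf_lax_lipschitz hamH K0 (g_ge0 t) W_bounded). Qed.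

Let u_dynamic x s t : s <= t ->
  u (x, t) = hopf_lax H K (g t - g s) (fun y => u (y, s)) x.
Proof.
move=> st; rewrite /u /= -[in LHS](subrK (g s) (g t)).
by rewrite (hopf_laxD hamH K0 _ _ W_bounded)// subr_ge0 g_nondecr.
Qed.

(** A near-optimal point [y] over the short time [r] is at distance [O(r)], since the
    cost has slope [L + 1] and [u] slope [L]. There the test function can be expanded
    to first order, and the cost is bounded below by its value at the momentum [p0]. *)
Lemma hopf_lax_subsolution z : 0 < z.2 -> derivable g z.2 1 ->
  subsolution_at H (derive1 g z.2) u z.
Proof.
case: z => x t; rewrite [(x, t).2]/= => t0 dg phi tphi hphi.
set p0 := space_gradient phi (x, t); set phit := time_derivative phi (x, t).
set g' := derive1 g t.
have p0L : `|p0| <= L.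
  exact: (touching_gradient (z := (x, t)) tphi t0 L0 (u_lipschitz t) hphi).
have p0K : `|p0| <= K by rewrite (le_trans p0L)// lerDl.
have [C C0 HC] := hamiltonian_bounded hamH K0.
have Hp0 : 0 <= H p0 by exact: hamiltonian_ge0.
(* The speed that finite propagation allows to near-optimal points. *)
pose Cs := C * (`|g'| + 1) + 1.
have Cs0 : 0 < Cs by rewrite ltr_wpDl// mulr_ge0// addr_ge0.
apply/ler_addgt0Pr => e e0.
pose M := H p0 + Cs + 2.
have M0 : 0 < M by rewrite /M; lra.
pose eta := Num.min 1 (e / M).
have eta0 : 0 < eta by rewrite lt_min ltr01 divr_gt0.
have eta1 : eta <= 1 by rewrite ge_min lexx.
have etaM : eta * M <= e by rewrite -ler_pdivlMr// ge_min lexx orbT.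
have [r1 r10 hr1] := test_function_expansion (z := (x, t)) tphi t0 eta0.
have [r2 r20 hr2] := derivable_expansion dg eta0.
have [r3 r30 hr3] := near_displacement hphi.
have [r [r0 [rr1 Csr1] rr2 [rr3 Csr3]]] := common_step r10 r20 r30 (ltW Cs0).
pose tau := g t - g (t - r).
have tau0 : 0 <= tau by rewrite subr_ge0 g_nondecr// gerBl ltW.
have taur : tau <= (g' + eta) * r.
  have := hr2 (- r); rewrite normrN gtr0_norm// => /(_ rr2).
  by rewrite ler_norml -/g' /tau => /andP[+ _]; lra.
have tr : t - r <= t by rewrite gerBl ltW.
have : u (x, t) - eta * r < u (x, t) by rewrite gtrBl mulr_gt0.
rewrite {2}(u_dynamic x tr) -/tau => /hopf_lax_gt[y hy].
have close : norm1 (y - x) <= Cs * r.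
  have := cost_coercive hamH K0 HC (y - x) tau0.
  have := @u_lipschitz (t - r) x y => /=.
  have : u (x, t - r) <= u (x, t).
    rewrite (u_dynamic x tr); exact: (hopf_lax_ge_id hamH K0 _ _ (u_bounded _)).
  have : C * tau <= C * (`|g'| + 1) * r.
    rewrite -mulrA ler_wpM2l// (le_trans taur)// ler_pM2r//.
    by have := ler_norm g'; lra.
  have : eta * r <= r by rewrite ler_piMl// ltW.
  by rewrite /Cs; lra.
have cg := cost_ge hamH (y - x) tau0 p0K.
have touch : u (y, t - r) - phi (y, t - r) <= u (x, t) - phi (x, t).
  have := hr3 (y - x) (- r); rewrite /= normrN gtr0_norm// subrKC; apply => //.
  exact: le_lt_trans close _.
have expand : phi (y, t - r) <=
    phi (x, t) + dot p0 (y - x) - r * phit + eta * ((Cs + 1) * r).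
  have := hr1 (y - x) (- r); rewrite /= normrN gtr0_norm// subrKC.
  move=> /(_ (le_lt_trans close _) rr1) => /(_ Csr1).
  rewrite -/p0 -/phit ler_norml => /andP[_].
  have : eta * (norm1 (y - x) + r) <= eta * ((Cs + 1) * r).
    by rewrite ler_pM2l//; lra.
  by lra.
have tauH : tau * H p0 <= (g' + eta) * r * H p0 by rewrite ler_wpM2r.
rewrite -(ler_pM2l r0).
have : r * (eta * M) <= r * e by rewrite ler_pM2l.
by rewrite /M; lra.
Qed.

(** The competitor moves with the constant velocity [q] that is optimal for the momentum
    [p0], namely a subgradient of [H] at [p0]; an approximate one is enough. *)
Lemma hopf_lax_supersolution z : 0 < z.2 -> derivable g z.2 1 ->
  supersolution_at H (derive1 g z.2) u z.
Proof.
case: z => x t; rewrite [(x, t).2]/= => t0 dg phi tphi hphi.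
set p0 := space_gradient phi (x, t); set phit := time_derivative phi (x, t).
set g' := derive1 g t.
have Hp0 : 0 <= H p0 by exact: hamiltonian_ge0.
apply/ler_addgt0Pr => e e0.
have G0 : 0 < `|g'| + 1 by rewrite ltr_wpDl.
pose e1 := e / 2 / (`|g'| + 1).
have e10 : 0 < e1 by rewrite !divr_gt0.
(* The error e1 is multiplied by tau, which is at most (|g'| + 1) * r. *)
have [q hq] := approximate_subgradient p0 K hamH e10.
pose Cs := (`|g'| + 1) * norm1 q.
pose M := H p0 + Cs + 1.
have n0 : 0 <= Cs by rewrite mulr_ge0 ?norm1_ge0// ltW.
have M0 : 0 < M by rewrite /M; lra.
pose eta := Num.min 1 (e / 2 / M).
have eta0 : 0 < eta by rewrite lt_min ltr01 !divr_gt0.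
have eta1 : eta <= 1 by rewrite ge_min lexx.
have etaM : eta * M <= e / 2 by rewrite -ler_pdivlMr// ge_min lexx orbT.
have [r1 r10 hr1] := test_function_expansion (z := (x, t)) tphi t0 eta0.
have [r2 r20 hr2] := derivable_expansion dg eta0.
have [r3 r30 hr3] := near_displacement hphi.
have [r [r0 [rr1 Csr1] rr2 [rr3 Csr3]]] := common_step r10 r20 r30 n0.
pose tau := g t - g (t - r).
have tau0 : 0 <= tau by rewrite subr_ge0 g_nondecr// gerBl ltW.
have [taur rtau] : tau <= (g' + eta) * r /\ (g' - eta) * r <= tau.
  have := hr2 (- r); rewrite normrN gtr0_norm// => /(_ rr2).
  by rewrite ler_norml -/g' /tau => /andP[] + +; split; lra.
have tauG : tau <= (`|g'| + 1) * r.
  by rewrite (le_trans taur)// ler_pM2r//; have := ler_norm g'; lra.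
have tr : t - r <= t by rewrite gerBl ltW.
pose y := x + tau *: q.
have yx : y - x = tau *: q by rewrite /y addrC addKr.
have ny : norm1 (tau *: q) <= Cs * r.
  by rewrite norm1Z ger0_norm// /Cs mulrAC ler_wpM2r// norm1_ge0.
have step : u (y, t - r) - tau * (dot q p0 - H p0 + e1) <= u (x, t).
  rewrite (u_dynamic x tr) -/tau.
  apply: le_trans (hopf_lax_ge hamH K0 x y tau0 (u_bounded _)).
  rewrite lerD2l lerN2 yx; apply: cost_le => // p pK.
  have := ler_wpM2l tau0 (hq p pK).
  by rewrite dotZr dotDr dotNr (dotC p q); lra.
have touch : u (x, t) - phi (x, t) <= u (y, t - r) - phi (y, t - r).
  have := hr3 (tau *: q) (- r); rewrite /= normrN gtr0_norm//; apply => //.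
  exact: le_lt_trans ny _.
have expand : phi (x, t) + tau * dot p0 q - r * phit - eta * ((Cs + 1) * r) <=
    phi (y, t - r).
  have := hr1 (tau *: q) (- r); rewrite /= normrN gtr0_norm//.
  move=> /(_ (le_lt_trans ny _) rr1) => /(_ Csr1).
  rewrite -/p0 -/phit dotZr ler_norml => /andP[+ _].
  have : eta * (norm1 (tau *: q) + r) <= eta * ((Cs + 1) * r).
    by rewrite ler_pM2l//; lra.
  by rewrite /y; lra.
have tauH : (g' - eta) * r * H p0 <= tau * H p0 by rewrite ler_wpM2r.
have taue : tau * e1 <= r * (e / 2).
  apply: le_trans (_ : (`|g'| + 1) * r * e1 <= _).
    by rewrite ler_wpM2r// ltW.
  by rewrite /e1 mulrAC [X in X * r]mulrC divfK ?gt_eqF// mulrC.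
rewrite -(ler_pM2l r0).
have : r * (eta * M) <= r * (e / 2) by rewrite ler_pM2l.
rewrite (dotC q p0) in step.
by rewrite /M; lra.
Qed.

Lemma hopf_lax_solution z : 0 < z.2 -> derivable g z.2 1 ->
  solution_at H (derive1 g z.2) u z.
Proof.
by move=> z0 dg; split; [exact: hopf_lax_subsolution|exact: hopf_lax_supersolution].
Qed.

End hopf_lax_viscosity.

(** * A smooth ramp *)

Section ramp.
Variable R : realType.
Implicit Types s t x : R.

Definition pos_sq x : R := Num.max 0 x ^+ 2.

Lemma is_derive_pos_sq x : is_derive x 1 pos_sq (2 * Num.max 0 x).
Proof.
have err h : `|pos_sq (h + x) - pos_sq x - 2 * Num.max 0 x * h| <= `|h| ^+ 2.
  rewrite /pos_sq real_normK ?num_real//.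
  by rewrite ler_norml; have [] := leP 0 (h + x); have [] := leP 0 x; nra.
have lim : h^-1 *: (pos_sq (h *: 1 + x) - pos_sq x) @[h --> 0^'] -->
    (2 * Num.max 0 x : R).
  apply/cvgrPdist_le => e e0; near=> h.
  have h0 : h != 0 by near: h; exact: nbhs_dnbhs_neq.
  have he : `|h| <= e by near: h; apply: dnbhs0_le.
  have := err h; rewrite [h *: 1]mulr1.
  have -> : 2 * Num.max 0 x - h^-1 *: (pos_sq (h + x) - pos_sq x) =
      - (h^-1 * (pos_sq (h + x) - pos_sq x - 2 * Num.max 0 x * h)).
    by rewrite /GRing.scale/=; field.
  rewrite normrN normrM normfV expr2 => /le_trans hb.
  by rewrite ler_pdivrMl ?normr_gt0//; apply: hb; rewrite ler_wpM2l.
apply: DeriveDef.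
  by apply/cvg_ex; exists (2 * Num.max 0 x).
exact/cvg_lim.
Unshelve. all: by end_near.
Qed.

(** A nondecreasing C^1 function equal to 0 up to 1/4 and to 1 from 3/4 on: half the
    second difference of the square of the positive part. *)
Definition ramp t : R :=
  2^-1 * (pos_sq (4 * t - 1) - 2 * pos_sq (4 * t - 2) + pos_sq (4 * t - 3)).

Definition ramp' t : R :=
  4 * (Num.max 0 (4 * t - 1) - 2 * Num.max 0 (4 * t - 2) + Num.max 0 (4 * t - 3)).

Lemma ramp_is_derive t : is_derive t 1 ramp (ramp' t).
Proof.
have aff b : is_derive t 1 (fun t : R => 4 * t - b) 4.
  have h := is_deriveB (is_deriveZ 4 (is_derive_id t (1 : R)))
    (is_derive_cst b t (1 : R)).
  by rewrite subr0 [4 *: 1]mulr1 in h.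
have sq b : is_derive t 1 (pos_sq \o (fun t : R => 4 * t - b))
    ((2 * Num.max 0 (4 * t - b)) *: 4).
  by apply: is_derive1_comp; exact: is_derive_pos_sq.
have h := is_deriveZ 2^-1 (is_deriveD (is_deriveB (sq 1) (is_deriveZ 2 (sq 2))) (sq 3)).
suff -> : ramp' t = 2^-1 *: ((2 * Num.max 0 (4 * t - 1)) *: 4 -
    2 *: ((2 * Num.max 0 (4 * t - 2)) *: 4) + (2 * Num.max 0 (4 * t - 3)) *: 4).
  exact: h.
by rewrite /ramp' /GRing.scale/=; field.
Qed.

Lemma continuous_ramp' : continuous ramp'.
Proof.
have c b : continuous (fun t : R => Num.max 0 (4 * t - b)).
  move=> t; apply: (@continuous_max _ _ (cst 0) (fun t : R => 4 * t - b)).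
    exact: cst_continuous.
  by apply: cvgB; [apply: cvgM; [exact: cvg_cst|exact: cvg_id]|exact: cvg_cst].
move=> t.
rewrite /continuous_at /ramp'; apply: cvgM; first exact: cvg_cst.
apply: cvgD; last exact: c.
by apply: cvgB; [exact: c|apply: cvgM; [exact: cvg_cst|exact: c]].
Qed.

Lemma ramp_left t : t <= 4^-1 -> ramp t = 0.
Proof.
move=> t4; rewrite /ramp /pos_sq !max_l; lra.
Qed.

Lemma ramp_right t : 3 / 4 <= t -> ramp t = 1.
Proof.
move=> t4; rewrite /ramp /pos_sq !max_r; lra.
Qed.

Lemma ramp'_left t : t <= 4^-1 -> ramp' t = 0.
Proof.
move=> t4; rewrite /ramp' !max_l; lra.
Qed.

Lemma ramp'_right t : 3 / 4 <= t -> ramp' t = 0.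
Proof.
move=> t4; rewrite /ramp' !max_r; lra.
Qed.

Lemma ramp_increment s t : s <= t -> 0 <= ramp t - ramp s <= 4 * (t - s).
Proof.
move=> st; have [||c _ ->] := @MVT_segment R ramp ramp' s t st.
- by move=> x _; exact: ramp_is_derive.
- apply: continuous_subspaceT => x; apply: differentiable_continuous.
  by apply/derivable1_diffP; have [] := ramp_is_derive x.
have /andP[c0 c4] : 0 <= ramp' c <= 4.
  rewrite /ramp'; have [] := leP 0 (4 * c - 1); have [] := leP 0 (4 * c - 2);
    have [] := leP 0 (4 * c - 3); lra.
by rewrite mulr_ge0 ?subr_ge0//= ler_wpM2r// subr_ge0.
Qed.

Lemma ramp_range t : 0 <= ramp t <= 1.
Proof.
have [t1|/ltW t1] := leP t 4^-1; first by rewrite ramp_left// lexx ler01.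
have [t2|/ltW t2] := leP (3 / 4) t; first by rewrite ramp_right// ler01 lexx.
have /andP[+ _] := ramp_increment t1; have /andP[+ _] := ramp_increment t2.
by rewrite (@ramp_left 4^-1)// (@ramp_right (3 / 4))//; lra.
Qed.

End ramp.

(** * Zigzag paths *)

Section zigzag.
Variables (R : realType) (N : R) (Z : nat -> R).
Hypothesis N0 : 0 < N.
Implicit Types (k l : nat) (t : R).

(** The path goes from [Z l] to [Z l.+1] in the middle half of the time interval from
    [l / N] to [l.+1 / N]. Because it rests around the mesh points, solutions on
    successive intervals need not be glued where the monotonicity changes. *)
Fixpoint zigzag k t : R :=
  if k is l.+1 then zigzag l t + (Z l.+1 - Z l) * ramp (N * t - l%:R) else Z 0.

Fixpoint zigzag' k t : R :=
  if k is l.+1 then zigzag' l t + (Z l.+1 - Z l) * (N * ramp' (N * t - l%:R)) else 0.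

Lemma is_derive_ramp_shift b t :
  is_derive t 1 (fun t => ramp (N * t - b)) (N * ramp' (N * t - b)).
Proof.
have h := is_deriveB (is_deriveZ N (is_derive_id t (1 : R))) (is_derive_cst b t (1 : R)).
rewrite subr0 [N *: 1]mulr1 in h.
rewrite [N * ramp' _]mulrC.
exact: (is_derive1_comp (f := @ramp R) (g := fun t => N * t - b) (ramp_is_derive _) h).
Qed.

Lemma zigzag_is_derive k t : is_derive t 1 (zigzag k) (zigzag' k t).
Proof.
elim: k => [|k IH] /=; first exact: is_derive_cst.
exact: (is_deriveD IH (is_deriveZ (Z k.+1 - Z k) (is_derive_ramp_shift k%:R t))).
Qed.

Lemma derive1_zigzag k : derive1 (zigzag k) = zigzag' k.
Proof.
by apply/funext => t; have h := zigzag_is_derive k t; rewrite derive1E derive_val.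
Qed.

Lemma continuous_zigzag' k : continuous (zigzag' k).
Proof.
elim: k => [|k IH] t /=; first exact: cvg_cst.
apply: cvgD; first exact: IH.
apply: cvgM; first exact: cvg_cst.
apply: cvgM; first exact: cvg_cst.
apply: (@continuous_comp _ _ _ (fun t => N * t - k%:R) (@ramp' R)).
  by apply: cvgB; [apply: cvgM; [exact: cvg_cst|exact: cvg_id]|exact: cvg_cst].
exact: continuous_ramp'.
Qed.

Lemma zigzag'_rest k t : k%:R - 4^-1 <= N * t -> zigzag' k t = 0.
Proof.
elim: k => [//|k IH] /=; rewrite -natr1 => kt.
rewrite IH ?ramp'_right ?mulr0 ?addr0//; lra.
Qed.

Lemma zigzag_rest k t : k%:R - 4^-1 <= N * t -> zigzag k t = Z k.
Proof.
elim: k => [//|k IH] /=; rewrite -natr1 => kt.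
rewrite IH ?ramp_right ?mulr1 ?subrKC//; lra.
Qed.

Lemma zigzag_start k t : t <= 0 -> zigzag k t = Z 0.
Proof.
move=> t0; elim: k => [//|k IH] /=; rewrite IH ramp_left ?mulr0 ?addr0//.
have : N * t <= 0 by rewrite pmulr_rle0.
have : 0 <= k%:R :> R by []; lra.
Qed.

Lemma C1_path_zigzag k : Z 0 = 0 -> C1_path (zigzag k).
Proof.
move=> Z0; have dz t : derivable (zigzag k) t 1 by have [] := zigzag_is_derive k t.
split.
- by rewrite zigzag_start.
- split=> [t _|]; first exact: dz.
  apply: cvg_at_right_filter; apply: differentiable_continuous.
  exact/derivable1_diffP.
- by rewrite derive1_zigzag => t _; exact: continuous_zigzag'.
- rewrite derive1_zigzag; apply/cvg_ex; exists (zigzag' k 0).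
  by apply: cvg_at_right_filter; exact: continuous_zigzag'.
Qed.

Lemma zigzag_close (zeta : R -> R) T w k t :
  (forall l, Z l = zeta (l%:R / N)) ->
  (forall s t, 0 <= s <= T -> 0 <= t <= T -> `|s - t| <= N^-1 ->
    `|zeta s - zeta t| <= w) ->
  k%:R <= N * T -> 0 <= t -> N * t <= k%:R -> `|zigzag k t - zeta t| <= 2 * w.
Proof.
move=> ZE hw; elim: k => [|k IH] kT t0 tk.
  have -> : t = 0 by apply/eqP; rewrite eq_le t0 andbT -(ler_pM2l N0) mulr0.
  rewrite /= ZE mul0r subrr normr0.
  have T0 : 0 <= T by rewrite -(ler_pM2l N0) mulr0.
  have := hw 0 0; rewrite !lexx T0 !subrr !normr0 => /(_ isT isT).
  by rewrite invr_ge0 ltW// => /(_ isT); lra.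
have kT' : k%:R <= N * T by apply: le_trans kT; rewrite ler_nat.
have [tk'|/ltW kt] := leP (N * t) k%:R.
  have k0 : N * t - k%:R <= 4^-1 by lra.
  by rewrite /= ramp_left// mulr0 addr0 IH.
rewrite /= zigzag_rest; last by lra.
have inT l : l%:R <= N * T -> 0 <= l%:R / N <= T.
  by move=> lT; rewrite divr_ge0 ?(ltW N0)//= ler_pdivrMr// mulrC.
have tT : 0 <= t <= T by rewrite t0/= -(ler_pM2l N0) (le_trans tk).
have NN : N^-1 * N = 1 by rewrite mulVf// gt_eqF.
have h1 : `|Z k - zeta t| <= w.
  rewrite ZE; apply: hw => //; first exact: inT.
  rewrite distrC ger0_norm; last by rewrite subr_ge0 ler_pdivrMr// mulrC.
  rewrite -(ler_pM2r N0) mulrBl divfK ?gt_eqF// NN mulrC.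
  by move: tk; rewrite -natr1; lra.
have h2 : `|Z k.+1 - Z k| <= w.
  rewrite !ZE; apply: hw; [exact: inT|exact: inT|].
  by rewrite -mulrBl -natr1 addrAC subrr add0r mul1r gtr0_norm ?invr_gt0.
have := ramp_range (N * t - k%:R) => /andP[r0 r1].
set r := ramp _ in r0 r1 *.
have : `|(Z k.+1 - Z k) * r| <= w.
  rewrite normrM (ger0_norm r0).
  by apply: le_trans h2; rewrite ler_piMr.
have := ler_normD (Z k - zeta t) ((Z k.+1 - Z k) * r).
have -> : Z k + (Z k.+1 - Z k) * r - zeta t = Z k - zeta t + (Z k.+1 - Z k) * r by ring.
lra.
Qed.

End zigzag.

(** * Solutions along zigzag paths *)

Section zigzag_solution.
Variables (R : realType) (d : nat) (H : 'rV[R]_d -> R) (L B N : R) (Z : nat -> R).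
Variable (v0 : 'rV[R]_d -> R).
Hypotheses (hamH : hamiltonian H) (L0 : 0 <= L) (N0 : 0 < N).
Hypotheses (v0_bounded : bounded_by B v0) (v0_lipschitz : lipschitz1 L v0).
Implicit Types (k l : nat) (s t : R) (x y : 'rV[R]_d).
Local Notation K := (L + 1).

Let K0 : 0 <= K. Proof. by rewrite addr_ge0. Qed.

(** Nesting the pieces needs no case analysis on the time: the pieces already
    completed contribute their full increment, and those to come the identity. *)
Fixpoint zigzag_sol k (z : 'rV[R]_d * R) : R :=
  if k is l.+1 then
    evolution H K ((Z l.+1 - Z l) * ramp (N * z.2 - l%:R))
      (fun y => zigzag_sol l (y, z.2)) z.1
  else v0 z.1.

(** The value of the solution at the mesh times, where the path rests. *)
Fixpoint rest_state k : 'rV[R]_d -> R :=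
  if k is l.+1 then evolution H K (Z l.+1 - Z l) (rest_state l) else v0.

Lemma lipschitz_regular (W : 'rV[R]_d -> R) :
  bounded_by B W -> lipschitz1 L W -> regular K B W.
Proof.
move=> hB hL; split => // x y; apply: le_trans (hL x y) _.
by rewrite ler_wpM2r ?norm1_ge0// lerDl.
Qed.

Lemma zigzag_sol_regular k t :
  bounded_by B (fun y => zigzag_sol k (y, t)) /\
  lipschitz1 L (fun y => zigzag_sol k (y, t)).
Proof.
elim: k => [//|k [hB hL]] /=; have reg := lipschitz_regular hB hL.
by split; [exact: (evolution_bounded K0 _ hamH reg)
          |exact: (evolution_lipschitz K0 _ hamH reg hL)].
Qed.

Lemma zigzag_sol_regularK k t : regular K B (fun y => zigzag_sol k (y, t)).
Proof. by have [? ?] := zigzag_sol_regular k t; exact: lipschitz_regular. Qed.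

Lemma zigzag_sol_rest k t : k%:R - 4^-1 <= N * t ->
  (fun y => zigzag_sol k (y, t)) = rest_state k.
Proof.
elim: k => [//|k IH] /=; rewrite -natr1 => kt.
rewrite IH; last by lra.
by rewrite ramp_right ?mulr1//; lra.
Qed.

Lemma rest_state_regular k : bounded_by B (rest_state k) /\ lipschitz1 L (rest_state k).
Proof.
rewrite -(@zigzag_sol_rest k (k%:R / N)); first exact: zigzag_sol_regular.
by rewrite mulrC divfK ?gt_eqF//; lra.
Qed.

Lemma rest_state_regularK k : regular K B (rest_state k).
Proof. by have [? ?] := rest_state_regular k; exact: lipschitz_regular. Qed.

Lemma rest_state_periodic k : periodic v0 -> periodic (rest_state k).
Proof.
move=> p0; elim: k => [//|k IH] /=.
exact: (evolution_periodic K0 _ hamH (rest_state_regularK k) IH).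
Qed.

Lemma zigzag_sol_range k l t b c : k%:R <= N * t -> (k <= l)%N ->
  (forall y, b <= rest_state k y <= c) -> forall x, b <= zigzag_sol l (x, t) <= c.
Proof.
move=> kt; elim: l => [|l IH].
  by rewrite leqn0 => /eqP ->.
rewrite leq_eqVlt => /predU1P[<- hbc x|].
  by rewrite (_ : zigzag_sol k (x, t) = rest_state k x)// -(@zigzag_sol_rest k t)//; lra.
rewrite ltnS => kl hbc x /=.
by apply: (evolution_range K0 _ hamH (zigzag_sol_regularK l t)) => y; exact: IH.
Qed.

Lemma zigzag_sol_initial k x t : t <= 0 -> zigzag_sol k (x, t) = v0 x.
Proof.
move=> t0; elim: k x => [//|k IH] x /=.
rewrite ramp_left; last first.
  have : N * t <= 0 by rewrite pmulr_rle0.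
  by have : 0 <= k%:R :> R by []; lra.
by rewrite mulr0 (evolution0 K0 hamH (zigzag_sol_regularK k t)) IH.
Qed.

Lemma zigzag_sol_time k : exists2 C, 0 <= C &
  forall x s t, `|zigzag_sol k (x, s) - zigzag_sol k (x, t)| <= C * `|s - t|.
Proof.
have [C C0 HC] := hamiltonian_bounded hamH K0.
elim: k => [|k [C1 C10 IH]].
  by exists 0 => // x s t; rewrite /= subrr normr0 mul0r.
pose a := Z k.+1 - Z k.
have ramp_lip s t : `|ramp (N * s - k%:R) - ramp (N * t - k%:R)| <= 4 * N * `|s - t|.
  wlog st : s t / s <= t.
    by move=> h; have [/h//|/ltW/h] := leP s t; rewrite distrC (distrC t).
  have st' : N * s - k%:R <= N * t - k%:R by rewrite lerB// ler_pM2l.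
  have /andP[h1 h2] := ramp_increment st'.
  by rewrite distrC (distrC s) !ger0_norm ?subr_ge0//; lra.
exists (C * (`|a| * (4 * N)) + C1).
  by rewrite addr_ge0// mulr_ge0// mulr_ge0// mulr_ge0// ltW.
move=> x s t /=; rewrite -/a.
set rs := ramp (N * s - _); set rt := ramp (N * t - _).
have /andP[rs0 _] : 0 <= rs <= 1 by exact: ramp_range.
have /andP[rt0 _] : 0 <= rt <= 1 by exact: ramp_range.
have regs := zigzag_sol_regularK k s; have regt := zigzag_sol_regularK k t.
have sgn : 0 <= a * rs /\ 0 <= a * rt \/ a * rs <= 0 /\ a * rt <= 0.
  have [a0|/ltW a0] := leP 0 a; [left|right].
    by split; rewrite mulr_ge0.
  by split; rewrite mulr_le0_ge0.
have h1 := evolution_time K0 x hamH HC regs sgn.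
have h2 : C * `|a * rs - a * rt| <= C * (`|a| * (4 * N)) * `|s - t|.
  rewrite -mulrA ler_wpM2l// -mulrBr normrM -mulrA ler_wpM2l//.
  exact: ramp_lip.
have hst y : zigzag_sol k (y, s) <= zigzag_sol k (y, t) + C1 * `|s - t|.
  by have := IH y s t; rewrite ler_norml => /andP[]; lra.
have hts y : zigzag_sol k (y, t) <= zigzag_sol k (y, s) + C1 * `|s - t|.
  by have := IH y s t; rewrite ler_norml => /andP[]; lra.
have h3 := evolution_shift K0 (a * rt) hamH regs regt hst x.
have h4 := evolution_shift K0 (a * rt) hamH regt regs hts x.
move: (le_trans h1 h2); rewrite !ler_norml => /andP[h5 h6].
by apply/andP; split; lra.
Qed.

Lemma zigzag_sol_BUC k T : BUC (slab (d := d) T) (zigzag_sol k).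
Proof.
apply/BUCP; split.
  by exists B => -[x t] _; exact: (zigzag_sol_regular k t).1.
have [C C0 hC] := zigzag_sol_time k.
have hL t := (zigzag_sol_regular k t).2.
move=> e e0; pose M := L * d%:R + C + 1.
have M0 : 0 < M by rewrite ltr_wpDl// addr_ge0// mulr_ge0.
exists (e / M); first by rewrite divr_gt0.
move=> [x t] [y s] _ _; rewrite ltr_pdivlMr// => hxy.
apply: le_lt_trans hxy.
set n : R := `|(x, t) - (y, s)|.
have nx : `|x - y| <= n by rewrite /n prod_normE le_max lexx.
have nt : `|t - s| <= n by rewrite /n prod_normE le_max lexx orbT.
have lx : L * norm1 (x - y) <= L * d%:R * n.
  rewrite -mulrA ler_wpM2l//; apply: le_trans (norm1_le _) _.
  by rewrite ler_wpM2l.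
have lt : C * `|t - s| <= C * n by rewrite ler_wpM2l.
have n0 : 0 <= n by exact: normr_ge0.
have := hC x t s; have := hL s x y; have := hL s y x; rewrite (norm1_distC y x).
rewrite !ler_norml => h1 h2 /andP[h3 h4].
by rewrite /M; apply/andP; split; lra.
Qed.

(** Before the last piece starts to move the induction hypothesis applies; afterwards
    the earlier pieces are at rest and a single Hopf-Lax operator, or its reflection,
    is at work. The two time ranges are open and cover everything. *)
Lemma zigzag_sol_solution_at k (z : 'rV[R]_d * R) : 0 < z.2 ->
  solution_at H (derive1 (zigzag N Z k) z.2) (zigzag_sol k) z.
Proof.
elim: k z => [|k IH] [x t]; rewrite [(x, t).2]/= => t0.
  have d0 : derivable (cst 0 : R -> R) t 1 by exact: derivable_cst.
  have := hopf_lax_solution hamH L0 v0_bounded v0_lipschitz (g := cst 0)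
    (fun=> lexx _) (fun _ _ _ => lexx _) (z := (x, t)) t0 d0.
  rewrite !derive1_cst; apply: solution_at_near; near=> w.
  rewrite /= (hopf_lax0 hamH K0 v0_bounded)//.
  exact: (lipschitz_regular v0_bounded v0_lipschitz).2.
pose a := Z k.+1 - Z k.
have near_time (P : R -> Prop) : (\forall s \near t, P s) ->
    \forall w \near (x, t), P w.2.
  move=> hP; exists (setT, [set s | P s]) => /=; first by split => //; exact: filterT.
  by move=> -[y s] [].
rewrite derive1_zigzag [zigzag' _ _ _ _]/= -/a.
have [tk|kt] := ltP (N * t) (k%:R + 4^-1).
  rewrite ramp'_left; last by lra.
  rewrite !mulr0 addr0 -derive1_zigzag.
  apply: solution_at_near (IH (x, t) t0).
  have before : \forall w \near (x, t), N * w.2 < k%:R + 4^-1.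
    apply: (near_time (fun s => N * s < k%:R + 4^-1)).
    have : t < (k%:R + 4^-1) / N by rewrite ltr_pdivlMr// mulrC.
    by move=> /lt_nbhsl; apply: filterS => s; rewrite ltr_pdivlMr// mulrC.
  near=> w; rewrite /= ramp_left; last first.
    have : N * w.2 < k%:R + 4^-1 by near: w.
    lra.
  rewrite mulr0 (evolution0 K0 hamH (zigzag_sol_regularK k _)).
  by rewrite -surjective_pairing.
rewrite zigzag'_rest ?add0r; last by lra.
have after : \forall w \near (x, t), k%:R - 4^-1 < N * w.2.
  apply: (near_time (fun s => k%:R - 4^-1 < N * s)).
  have : (k%:R - 4^-1) / N < t by rewrite ltr_pdivrMr// mulrC; lra.
  by move=> /lt_nbhsr; apply: filterS => s; rewrite ltr_pdivrMr// mulrC.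
have rest_near : \forall w \near (x, t), zigzag_sol k.+1 w =
    evolution H K (a * ramp (N * w.2 - k%:R)) (rest_state k) w.1.
  near=> w; rewrite /= -/a zigzag_sol_rest//.
  by apply/ltW; near: w.
have [restB restL] := rest_state_regular k.
have restR := rest_state_regularK k.
have scaled_ramp b : is_derive t 1 (fun t => b * ramp (N * t - k%:R))
    (b * (N * ramp' (N * t - k%:R))).
  exact: (is_deriveZ b (is_derive_ramp_shift N k%:R t)).
have scaled_ge0 b s : 0 <= b -> 0 <= b * ramp (N * s - k%:R).
  by move=> b0; rewrite mulr_ge0//; have /andP[] := ramp_range (N * s - k%:R).
have scaled_incr b : 0 <= b -> {homo (fun t => b * ramp (N * t - k%:R)) : s t / s <= t}.
  move=> b0 s s' ss'; rewrite ler_wpM2l//.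
  have : N * s - k%:R <= N * s' - k%:R by rewrite lerB// ler_pM2l.
  by move/ramp_increment => /andP[]; lra.
have [a0|/ltW a0] := leP 0 a.
  have hd := scaled_ramp a.
  have := hopf_lax_solution hamH L0 restB restL (fun s => scaled_ge0 a s a0)
    (scaled_incr a a0) (z := (x, t)) t0 (@ex_derive _ _ _ _ _ _ _ hd).
  rewrite derive1E derive_val; apply: solution_at_near.
  near=> w; rewrite (near rest_near w)//.
  by rewrite evolutionE// scaled_ge0.
apply: solution_atN => //.
have a0' : 0 <= - a by rewrite oppr_ge0.
have hd := scaled_ramp (- a).
have := hopf_lax_solution (hamiltonian_opp hamH) L0 (bounded_byN restB)
  (lipschitz1N restL) (fun s => scaled_ge0 (- a) s a0')
  (scaled_incr (- a) a0') (z := (x, t)) t0 (@ex_derive _ _ _ _ _ _ _ hd).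
rewrite derive1E derive_val mulNr; apply: solution_at_near.
near=> w; rewrite (near rest_near w)//.
rewrite (evolution_decr K0 hamH restR) ?opprK ?mulNr//.
by rewrite -oppr_ge0 -mulNr scaled_ge0.
Unshelve. all: by end_near.
Qed.

Lemma zigzag_sol_viscosity k :
  viscosity_solution H (zigzag N Z k) v0 (zigzag_sol k).
Proof.
split.
- by move=> T _; exact: zigzag_sol_BUC.
- by move=> x; exact: zigzag_sol_initial.
- by move=> phi z tphi z0; exact: (zigzag_sol_solution_at k z0).1.
- by move=> phi z tphi z0; exact: (zigzag_sol_solution_at k z0).2.
Qed.

End zigzag_solution.

(** * Meshes and Lipschitz data *)

Section approximation.
Variables (R : realType) (d : nat).
Implicit Types (x y : 'rV[R]_d) (H W : 'rV[R]_d -> R).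

Lemma lipschitz_approximation H W B : hamiltonian H -> bounded_by B W ->
  (forall e : R, 0 < e -> exists2 r : R, 0 < r &
     forall x y, `|x - y| < r -> `|W x - W y| < e) ->
  forall e : R, 0 < e -> exists n0 : nat, forall n : nat, (n0 <= n)%N ->
    forall x, W x <= hopf_lax H n%:R 0 W x <= W x + e.
Proof.
move=> hamH hB ucW e e0; have [r r0 hr] := ucW e e0.
have B0 : 0 <= B by have := hB 0; exact: le_trans.
exists (Num.truncn (2 * B / r)).+1 => n nB x.
have nr : 2 * B <= n%:R * r.
  rewrite -ler_pdivrMr//; apply/ltW; apply: lt_le_trans (truncnS_gt _) _.
  by rewrite ler_nat.
rewrite (hopf_lax_ge_id hamH (ler0n _ n) x (lexx 0) hB)/=.
apply: hopf_lax_le => y; rewrite (cost0 hamH (ler0n _ n)).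
have n1 : 0 <= n%:R * norm1 (y - x) by rewrite mulr_ge0 ?norm1_ge0.
have [yx|yx] := ltP (norm1 (y - x)) r.
  have := hr y x (le_lt_trans (norm_le_norm1 _) yx).
  by rewrite ltr_norml => /andP[]; lra.
have : n%:R * r <= n%:R * norm1 (y - x) by rewrite ler_wpM2l.
have := hB x; have := hB y; rewrite !ler_norml => /andP[? ?] /andP[? ?]; lra.
Qed.

Lemma mesh_exists (zeta : R -> R) (T w : R) :
  {within `[0, +oo[, continuous zeta} -> 0 < w ->
  exists2 N : nat, (0 < N)%N &
    forall s t, 0 <= s <= T -> 0 <= t <= T -> `|s - t| <= N%:R^-1 ->
      `|zeta s - zeta t| <= w.
Proof.
move=> czeta w0; have [r r0 hr] := within_continuous_uniform T czeta w0.
exists (Num.truncn r^-1).+1 => // s t sT tT st; apply/ltW/hr => //.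
apply: le_lt_trans st _; rewrite invf_plt ?posrE//.
exact: truncnS_gt.
Qed.

Lemma near_mesh_point (N T : nat) (s : R) : (0 < N)%N -> 0 <= s <= T%:R ->
  exists2 i : nat, (i <= T * N)%N & `|s - i%:R / N%:R| <= N%:R^-1.
Proof.
move=> N0 /andP[s0 sT]; have NR : 0 < N%:R :> R by rewrite ltr0n.
have sN : 0 <= N%:R * s by rewrite mulr_ge0// ltW.
have /andP[h1 h2] := truncn_itv sN.
exists (Num.truncn (N%:R * s)).
  rewrite -(ler_nat R); apply: le_trans h1 _.
  by rewrite natrM mulrC ler_pM2r.
set i := (Num.truncn _)%:R in h1 *.
rewrite ger0_norm; last by rewrite subr_ge0 ler_pdivrMr// mulrC.
rewrite -(ler_pM2r NR) mulrBl divfK ?gt_eqF// mulVf ?gt_eqF// mulrC.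
by move: h2; rewrite -natr1 -/i; lra.
Qed.

(** Extremal mesh indices are used instead of extremal times of the path, so that the
    sequence stays exactly between its values at the two indices. *)
Lemma extremal_indices (Z : nat -> R) (m i1 i2 : nat) : (i1 <= m)%N -> (i2 <= m)%N ->
  exists i j : nat, [/\ (i <= j)%N, (j <= m)%N &
    (forall l, (i <= l <= j)%N -> Z i <= Z l) /\ Z i2 - Z i1 <= Z j - Z i \/
    (forall l, (i <= l <= j)%N -> Z l <= Z i) /\ Z i2 - Z i1 <= Z i - Z j].
Proof.
move=> i1m i2m.
pose o k : 'I_m.+1 := inord k.
have oE k : (k <= m)%N -> o k = k :> nat by move=> km; rewrite inordK.
have [a _ ha] := @arg_minP _ _ _ (o 0%N) xpredT (fun k : 'I_m.+1 => Z k) isT.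
have [b _ hb] := @arg_maxP _ _ _ (o 0%N) xpredT (fun k : 'I_m.+1 => Z k) isT.
have {}ha k : (k <= m)%N -> Z a <= Z k.
  by move=> km; rewrite -(oE _ km); exact: ha.
have {}hb k : (k <= m)%N -> Z k <= Z b.
  by move=> km; rewrite -[in Z k](oE _ km); exact: hb.
have am : (a <= m)%N by rewrite -ltnS.
have bm : (b <= m)%N by rewrite -ltnS.
have D : Z i2 - Z i1 <= Z b - Z a by rewrite lerB ?ha ?hb.
have [ab|/ltnW ba] := leqP a b; [exists a, b|exists b, a]; split => //.
  by left; split => // l /andP[_ lb]; apply: ha; exact: leq_trans lb bm.
by right; split => // l /andP[_ la]; apply: hb; exact: leq_trans la am.
Qed.

Lemma rest_state_flat H (L B N D e : R) (Z : nat -> R) (v0 : 'rV[R]_d -> R)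
    (m i1 i2 : nat) :
  hamiltonian H -> 0 <= L -> 0 < N -> bounded_by B v0 -> lipschitz1 L v0 ->
  periodic v0 ->
  (forall t z, D <= t -> norm1 z <= d%:R -> cost H (L + 1) t z <= e) ->
  (i1 <= m)%N -> (i2 <= m)%N -> D <= Z i2 - Z i1 ->
  exists2 j : nat, (j <= m)%N &
    forall x y, rest_state H L Z v0 j y <= rest_state H L Z v0 j x + e.
Proof.
move=> hamH L0 N0 hB hL perv he i1m i2m DZ.
have K0 : 0 <= L + 1 by rewrite addr_ge0.
have reg l : regular (L + 1) B (rest_state H L Z v0 l).
  exact: (rest_state_regularK Z hamH L0 N0).
have [i [j [ij jm ext]]] := extremal_indices Z i1m i2m; exists j => //.
have per := rest_state_periodic Z hamH L0 N0 hB hL i perv.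
case: ext => -[hZ hD].
  apply: (@evolution_flat_up _ _ _ K0 H _ Z B i) => // z zd; apply: he => //.
  exact: le_trans DZ hD.
apply: (@evolution_flat_down _ _ _ K0 H _ Z B i) => // z zd; apply: he => //.
exact: le_trans DZ hD.
Qed.

End approximation.

(** * Flattening *)

Section convergence.
Variables (R : realType) (d : nat).
Implicit Types (H : 'rV[R]_d -> R) (zeta : R -> R) (e T D : R).

Lemma lipschitz_BUC (W : 'rV[R]_d -> R) B L : 0 <= L -> bounded_by B W ->
  lipschitz1 L W -> BUC [set: 'rV[R]_d] W.
Proof.
move=> L0 hB hL; apply/BUCP; split; first by exists B.
move=> e e0; pose M := L * d%:R + 1.
have M0 : 0 < M by rewrite ltr_wpDl// mulr_ge0.
exists (e / M) => [|x y _ _]; first by rewrite divr_gt0.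
rewrite ltr_pdivlMr// => xy; apply: le_lt_trans xy.
have : L * norm1 (x - y) <= L * (d%:R * `|x - y|) by rewrite ler_wpM2l// norm1_le.
have n0 : 0 <= `|x - y| by exact: normr_ge0.
have := hL x y; have := hL y x; rewrite (norm1_distC y x) ler_norml /M.
by move=> *; apply/andP; split; lra.
Qed.

Definition resolving_mesh zeta (N : nat -> nat) : Prop :=
  forall n, (0 < N n)%N /\
    forall s t : R, 0 <= s <= n%:R -> 0 <= t <= n%:R -> `|s - t| <= (N n)%:R^-1 ->
      `|zeta s - zeta t| <= n.+1%:R^-1.

Lemma resolving_mesh_exists zeta : {within `[0, +oo[, continuous zeta} ->
  exists N, resolving_mesh zeta N.
Proof.
move=> czeta; pose P n N := (0 < N)%N /\
  forall s t : R, 0 <= s <= n%:R -> 0 <= t <= n%:R -> `|s - t| <= N%:R^-1 ->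
    `|zeta s - zeta t| <= n.+1%:R^-1.
have /choice[N hN] : forall n, exists N, P n N; last by exists N.
move=> n; have wn : 0 < n.+1%:R^-1 :> R by rewrite invr_gt0.
by have [k k0 hk] := mesh_exists n%:R czeta wn; exists k.
Qed.

Section approximants.
Variables (H : 'rV[R]_d -> R) (zeta : R -> R) (u0 : 'rV[R]_d -> R) (B : R).
Variable N : nat -> nat.
Hypotheses (hamH : hamiltonian H) (zeta0 : zeta 0 = 0).
Hypotheses (hN : resolving_mesh zeta N) (hB : bounded_by B u0).
Hypothesis ucu0 : forall e : R, 0 < e -> exists2 r : R, 0 < r &
     forall x y, `|x - y| < r -> `|u0 x - u0 y| < e.

Definition mesh_value n l : R := zeta (l%:R / (N n)%:R).
Definition approx_path n := zigzag (N n)%:R (mesh_value n) (n * N n).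
Definition approx_datum n := hopf_lax H n%:R 0 u0.
Definition approx_sol n :=
  zigzag_sol H n%:R (N n)%:R (mesh_value n) (approx_datum n) (n * N n).

Lemma mesh_gt0 n : 0 < (N n)%:R :> R.
Proof. by rewrite ltr0n (hN n).1. Qed.

Lemma approx_datum_bounded n : bounded_by B (approx_datum n).
Proof. exact: (hopf_lax_bounded hamH (ler0n _ n) (lexx 0) hB). Qed.

Lemma approx_datum_lipschitz n : lipschitz1 n%:R (approx_datum n).
Proof. exact: (hopf_lax_regular hamH (ler0n _ n) (lexx 0) hB). Qed.

Lemma approx_path_cvg (T : R) : {uniform `[0, T], approx_path @ \oo --> zeta}.
Proof.
apply/uniform_cvg_seqP => eta eta0.
exists (maxn (Num.truncn T).+1 (Num.truncn (2 / eta)).+1) => n r nT.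
rewrite /= in_itv/= => /andP[r0 rT].
move: nT; rewrite geq_max => /andP[nT neta].
have Tn : T <= n%:R.
  by apply/ltW; apply: lt_le_trans (truncnS_gt _) _; rewrite ler_nat.
have rn : r <= n%:R by exact: le_trans rT Tn.
have := @zigzag_close _ _ (mesh_value n) (mesh_gt0 n) zeta n%:R n.+1%:R^-1 (n * N n) r
  (fun _ => erefl) (hN n).2.
rewrite natrM mulrC lexx => /(_ isT r0).
rewrite ler_pM2l ?mesh_gt0// => /(_ rn).
rewrite distrC => /le_lt_trans; apply.
rewrite ltr_pdivrMr// mulrC -ltr_pdivrMr//.
by apply: lt_le_trans (truncnS_gt _) _; rewrite ler_nat; exact: leqW.
Qed.

Lemma approx_datum_cvg : {uniform, approx_datum @ \oo --> u0}.
Proof.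
apply/uniform_cvg_seqP => eta eta0.
have eta2 : 0 < eta / 2 by rewrite divr_gt0.
have [n0 hn0] := lipschitz_approximation hamH hB ucu0 eta2.
exists n0 => n r /hn0 /(_ r) + _; rewrite ltr_norml -/(approx_datum n) => /andP[h1 h2].
by apply/andP; split; lra.
Qed.

Lemma approx_sol_cvg u T : pathwise_solution H zeta u0 u -> 0 < T ->
  {uniform slab T, approx_sol @ \oo --> u}.
Proof.
move=> hu; apply: (hu approx_path approx_datum) => [n|S _|n||n].
- by apply: C1_path_zigzag; rewrite ?mesh_gt0// /mesh_value mul0r.
- exact: approx_path_cvg.
- exact: lipschitz_BUC (ler0n _ n) (approx_datum_bounded n) (approx_datum_lipschitz n).
- exact: approx_datum_cvg.
- exact: (zigzag_sol_viscosity (mesh_value n) hamH (ler0n _ n) (mesh_gt0 n)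
    (approx_datum_bounded n) (approx_datum_lipschitz n)).
Qed.

End approximants.

Lemma path_oscillation zeta D : {within `[0, +oo[, continuous zeta} ->
  (exists t : nat -> R, t @ \oo --> +oo /\
    (fun n => running_max zeta (t n) - running_min zeta (t n)) @ \oo --> +oo) ->
  exists (T : nat) (s1 s2 : R),
    [/\ 0 <= s1 <= T%:R, 0 <= s2 <= T%:R & D <= zeta s2 - zeta s1].
Proof.
move=> czeta [t [too oscoo]].
have [n [tn oscn]] : exists n, 0 <= t n /\
    D <= running_max zeta (t n) - running_min zeta (t n).
  have h1 : \forall n \near \oo, 0 <= t n by move/cvgryPge : too; exact.
  have h2 : \forall n \near \oo, D <= running_max zeta (t n) - running_min zeta (t n).
    by move/cvgryPge : oscoo; exact.
  have [k _ hk] := filterI h1 h2; exists k; exact: (hk k (leqnn k)).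
have czn : {within `[0, t n], continuous zeta}.
  apply: continuous_subspaceW czeta => s /=; rewrite !in_itv/= andbT.
  by case/andP.
have [s2 s2n hs2] := EVT_max tn czn; have [s1 s1n hs1] := EVT_min tn czn.
have tT : t n <= (Num.truncn (t n)).+1%:R by rewrite ltW// truncnS_gt.
exists (Num.truncn (t n)).+1, s1, s2; split.
- by move: s1n; rewrite in_itv/= => /andP[->/= h]; exact: le_trans h tT.
- by move: s2n; rewrite in_itv/= => /andP[->/= h]; exact: le_trans h tT.
apply: le_trans oscn _; apply: lerB.
  apply: ge_sup => [|_ [s sn <-]]; last exact: hs2.
  by exists (zeta s1); exists s1.
apply: lb_le_inf => [|_ [s sn <-]]; last exact: hs1.
by exists (zeta s1); exists s1.
Qed.

(** The estimate is proved for the approximate solutions: their datum is periodic, their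
    path agrees with [zeta] on a mesh that sees its oscillation up to time [T], and the
    resulting bound does not depend on the approximation. *)
Lemma flattening H zeta (u : 'rV[R]_d * R -> R) e : hamiltonian H -> C0_path zeta ->
  BUC (halfspace R d) u -> space_periodic u ->
  pathwise_solution H zeta (fun x => u (x, 0)) u ->
  (exists t : nat -> R, t @ \oo --> +oo /\
    (fun n => running_max zeta (t n) - running_min zeta (t n)) @ \oo --> +oo) ->
  0 < e ->
  exists T : nat, forall x y (t s : R), T%:R <= t -> T%:R <= s ->
    `|u (x, t) - u (y, s)| <= e.
Proof.
move=> hamH zetaC /BUCP[[B hB] ucu] uper usol osc e0.
pose u0 x := u (x, 0).
have half t (x : 'rV[R]_d) : 0 <= t -> halfspace R d (x, t).
  by move=> t0; split => //=; rewrite in_itv/= t0.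
have u0B : bounded_by B u0 by move=> x; apply: hB; exact: half.
have u0uc (eta : R) : 0 < eta -> exists2 r : R, 0 < r &
    forall x y, `|x - y| < r -> `|u0 x - u0 y| < eta.
  move=> /ucu [r r0 hr]; exists r => // x y xy; apply: hr; [exact: half|exact: half|].
  have -> : (x, 0 : R) - (y, 0) = (x - y, 0) by congr pair; rewrite /= subr0.
  by rewrite prod_normE/= normr0 gt_max xy r0.
have u0per : periodic u0 by move=> x k; exact: uper.
have e4 : 0 < e / 4 by rewrite divr_gt0.
have [D D0 hD] := cost_vanishes hamH (ler0n R d) e4.
have [T [s1 [s2 [s1T s2T Ds]]]] := path_oscillation (D + 2) zetaC.2 osc.
exists T => x y t s Tt Ts.
have t0 : 0 <= t by exact: le_trans Tt.
have s0 : 0 <= s by exact: le_trans Ts.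
have [N hN] := resolving_mesh_exists zetaC.2.
have T0 : 0 < Num.max t s + 1 by rewrite ltr_pwDr// le_max t0.
have /uniform_cvg_seqP /(_ _ e4) [n0 hn0] :=
  approx_sol_cvg hamH zetaC.1 hN u0B u0uc usol T0.
pose n := maxn n0 T.
have nT : (T <= n)%N by exact: leq_maxr.
have ux : `|u (x, t) - approx_sol H zeta u0 N n (x, t)| < e / 4.
  apply: hn0 (leq_maxl _ _) _; split => //=; rewrite in_itv/= t0.
  by rewrite ler_wpDr// le_max lexx.
have uy : `|u (y, s) - approx_sol H zeta u0 N n (y, s)| < e / 4.
  apply: hn0 (leq_maxl _ _) _; split => //=; rewrite in_itv/= s0.
  by rewrite ler_wpDr// le_max lexx orbT.
pose Z := mesh_value zeta N n.
have NR : 0 < (N n)%:R :> R by exact: mesh_gt0 hN n.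
pose v0 := approx_datum H u0 n.
have v0B : bounded_by B v0 by exact: approx_datum_bounded.
have v0L : lipschitz1 n%:R v0 by exact: (approx_datum_lipschitz hamH u0B).
have v0per : periodic v0.
  exact: (hopf_lax_periodic hamH (ler0n _ n) (lexx 0) u0B u0per).
have [i1 i1T hi1] := near_mesh_point (hN n).1 s1T.
have [i2 i2T hi2] := near_mesh_point (hN n).1 s2T.
have mesh_in i : (i <= T * N n)%N -> 0 <= (i%:R / (N n)%:R : R) <= n%:R.
  move=> iT; rewrite divr_ge0//= ler_pdivrMr// -natrM ler_nat.
  by apply: leq_trans iT _; rewrite leq_mul2r nT orbT.
have inn (r : R) : 0 <= r <= T%:R -> 0 <= r <= n%:R.
  by move=> /andP[-> rT]/=; rewrite (le_trans rT)// ler_nat.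
have w1 : n.+1%:R^-1 <= 1 :> R by rewrite invf_le1// ler1n.
have DZ : D <= Z i2 - Z i1.
  have := le_trans ((hN n).2 _ _ (inn s1 s1T) (mesh_in i1 i1T) hi1) w1.
  have := le_trans ((hN n).2 _ _ (inn s2 s2T) (mesh_in i2 i2T) hi2) w1.
  rewrite !ler_norml /Z /mesh_value => /andP[_ h2] /andP[h1 _].
  by clear -d Ds h1 h2; lra.
have [j jT flat] : exists2 j : nat, (j <= T * N n)%N & forall x y,
    rest_state H n%:R Z v0 j y <= rest_state H n%:R Z v0 j x + e / 4.
  apply: (rest_state_flat hamH (ler0n _ n) NR v0B v0L v0per _ i1T i2T DZ) => r z Dr zd.
  by apply: hD => //; rewrite addr_ge0.
have jn : (j <= n * N n)%N by apply: leq_trans jT _; rewrite leq_mul2r nT orbT.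
have late (r : R) : T%:R <= r -> j%:R <= (N n)%:R * r.
  move=> Tr; apply: le_trans (_ : (N n)%:R * T%:R <= _); last by rewrite ler_pM2l.
  by rewrite -natrM ler_nat mulnC.
pose c := rest_state H n%:R Z v0 j 0.
have around z : c - e / 4 <= rest_state H n%:R Z v0 j z <= c + e / 4.
  by have := flat 0 z; have := flat z 0; rewrite -/c; lra.
have /andP[x1 x2] : c - e / 4 <= approx_sol H zeta u0 N n (x, t) <= c + e / 4.
  exact: (zigzag_sol_range hamH (ler0n _ n) v0B v0L (late _ Tt) jn around x).
have /andP[y1 y2] : c - e / 4 <= approx_sol H zeta u0 N n (y, s) <= c + e / 4.
  exact: (zigzag_sol_range hamH (ler0n _ n) v0B v0L (late _ Ts) jn around y).
move: ux uy; rewrite !ltr_norml ler_norml => /andP[u1 u2] /andP[u3 u4].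
by clear -d x1 x2 y1 y2 u1 u2 u3 u4; apply/andP; split; lra.
Qed.

End convergence.

(** * Convergence *)

Theorem theorem1p8 (R : realType) (d : nat) (hd : (0 < d)%N)
    (H : 'rV[R]_d -> R) (zeta : R -> R) (u : 'rV[R]_d * R -> R)
    (H_continuous : continuous H)
    (H_convex : convex_function [set: 'rV[R]_d] H)
    (H_zero : H 0 = 0)
    (H_pos : forall p : 'rV[R]_d, p != 0 -> 0 < H p)
    (zeta_path : C0_path zeta)
    (u_BUC : BUC (halfspace R d) u)
    (u_periodic : space_periodic u)
    (u_sol : pathwise_solution H zeta (fun x => u (x, 0)) u)
    (osc : exists t : nat -> R,
        t @ \oo --> +oo /\
        (fun n => running_max zeta (t n) - running_min zeta (t n))
          @ \oo --> +oo) :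
  exists u_infty : R,
    {uniform, (fun (t : R) (x : 'rV[R]_d) => u (x, t)) @ +oo -->
              (fun _ : 'rV[R]_d => u_infty)}.
Proof.
have hamH := convex_hamiltonian H_continuous H_convex H_zero H_pos.
have flat e := @flattening _ _ H zeta u e hamH zeta_path u_BUC u_periodic u_sol osc.
have /cvg_ex[u_infty /= u_lim] : cvg (u (0, t) @[t --> +oo]).
  apply/cauchy_cvgP/cauchy_exP => e e0.
  have e2 : 0 < e / 2 by rewrite divr_gt0.
  have [T hT] := flat _ e2; exists (u (0, T%:R)).
  suff h : \forall t \near +oo, ball (u (0, T%:R)) e (u (0, t)) by exact: h.
  near=> t; rewrite -ball_normE/=.
  have Tt : T%:R <= t by near: t; exact: nbhs_pinfty_ge.
  by have := hT 0 0 _ _ (lexx _) Tt; lra.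
exists u_infty => P /uniform_nbhs[E [entE sEP]].
move: entE; rewrite -entourage_ballE => -[e /= e0 eE].
have e2 : 0 < e / 2 by rewrite divr_gt0.
have [T hT] := flat _ e2.
suff h : \forall t \near +oo, P (fun x => u (x, t)) by exact: h.
near=> t; apply: sEP => x _; apply: (eE (u_infty, u (x, t))).
rewrite /= -ball_normE/=.
have Tt : T%:R <= t by near: t; exact: nbhs_pinfty_ge.
have [s [Ts us]] : exists s : R, T%:R <= s /\ `|u_infty - u (0, s)| < e / 2.
  have h1 : \forall s \near +oo, `|u_infty - u (0, s)| < e / 2.
    by move/cvgr_dist_lt : u_lim; exact.
  have h2 : \forall s \near +oo, (T%:R : R) <= s by exact: nbhs_pinfty_ge.
  by have [s [? ?]] := @filter_ex _ _ _ _ (filterI h2 h1); exists s.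
have := ler_distD (u (0, s)) u_infty (u (x, t)).
have := hT 0 x s t Ts Tt.
lra.
Unshelve. all: by end_near.
Qed.
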